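(* Let $h\colon\omega\to\omega$ be a function that is provably total in $\mathsf{RCA}_0$ and eventually dominates the function $n\mapsto k^n$ for every $k\in\omega$. Then there is an $\omega$-model of $\mathsf{WKL}_0+\neg\, h\mbox{-}\mathsf{WDR}$. Thus $\mathsf{WKL}_0\nvdash h\mbox{-}\mathsf{WDR}$, and therefore also $\mathsf{RCA}_0\nvdash\mathsf{MLR}\to h\mbox{-}\mathsf{WDR}$.
   Context: $\mathsf{RCA}_0$ is the theory in the language of second-order arithmetic with axioms: the basic axioms $\mathsf{PA}^-$ of Peano arithmetic (the natural numbers form a discretely ordered commutative semiring with $1$); the $\Sigma^0_1$ induction scheme, i.e. the universal closures of $(\varphi(0)\wedge\forall n(\varphi(n)\to\varphi(n+1)))\to\forall n\,\varphi(n)$ for $\varphi$ a $\Sigma^0_1$ formula; and the $\Delta^0_1$ comprehension scheme, i.e. the universal closures of $\forall n(\varphi(n)\leftrightarrow\psi(n))\to\exists X\forall n(n\in X\leftrightarrow\varphi(n))$ for $\varphi$ a $\Sigma^0_1$ and $\psi$ a $\Pi^0_1$ formula with $X$ not free in $\varphi$. Set parameters are allowed in formulas. $\mathsf{WKL}_0$ is $\mathsf{RCA}_0$ plus weak König's lemma: ''every infinite subtree of $2^{<\mathbb{N}}$ has an infinite path.'' $\omega$ denotes the standard natural numbers; an $\omega$-model is a structure $(\omega,\mathcal S)$ for second-order arithmetic whose first-order part is standard, with second-order part $\mathcal S\subseteq\mathcal P(\omega)$. A function $f$ eventually dominates $g$ if $(\exists n)(\forall m>n)(g(m)<f(m))$.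 A function $h\colon\omega\to\omega$ is provably total in $\mathsf{RCA}_0$ in the usual sense: it is defined by a parameter-free $\Sigma^0_1$ formula $\theta(n,m)$ such that $\mathsf{RCA}_0\vdash\forall n\exists! m\,\theta(n,m)$; this formula is used to express $h$ in the principle $h\mbox{-}\mathsf{WDR}$. The definitions below are made inside $\mathsf{RCA}_0$. $\mathbb{N}$ is the (possibly nonstandard) first-order part. Finite strings, finite sets and rationals are coded as usual; $(\Phi_e)_{e\in\mathbb{N}}$ is an effective sequence of all Turing functionals; $\leq_{\mathrm T}$ is Turing reducibility. $2^{<\mathbb{N}}$ is the set of finite binary strings, $|\sigma|$ is the length of $\sigma$. For a set $B$ of strings, $X\in[B]$ means some $\sigma\in B$ is an initial segment of $X$. Open sets: A code for a $\mathbf{\Sigma^0_1}$ (open) set $\mathcal U$ is a sequence $(B_i)_{i\in\mathbb{N}}$ of coded finite subsets of $2^{<\mathbb{N}}$; it codes a $\Sigma^{0,Z}_1$ set if $(B_i)_{i\in\mathbb{N}}\leq_{\mathrm T}Z$; a uniform sequence of $\Sigma^{0,Z}_1$ sets is coded by a double sequence $(B_{n,i})_{n,i\in\mathbb{N}}\leq_{\mathrm T}Z$. $X\in\mathcal U$ means $\exists i\,(X\in[B_i])$. For finite $B\subseteq 2^{<\mathbb{N}}$, $\mu(B)=\sum_{\sigma\in\widehat B}2^{-|\sigma|}$, where $\widehat B$ is the set of $\sigma\in B$ with no proper initial segment in $B$; $\mu(\mathcal U)\leq r$ means $\forall m\,(\mu(\bigcup_{i\leq m}B_i)\leq r)$.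 A Martin-Löf test relative to $Z$ is a uniform sequence $(\mathcal U_n)_{n\in\mathbb{N}}$ of $\Sigma^{0,Z}_1$ sets with $\forall n\,(\mu(\mathcal U_n)\leq 2^{-n})$. $X$ is $1$-random relative to $Z$ if $X\notin\bigcap_n\mathcal U_n$ for every such test. $\mathsf{MLR}$ is the statement ''for every $Z$ there is an $X$ that is $1$-random relative to $Z$.'' A (coded) $h$-r.e. function is a function $g\colon\mathbb{N}\times\mathbb{N}\to\mathbb{N}$ such that $|\{s:g(n,s)\neq g(n,s+1)\}|\leq h(n)$ for every $n$. For $h\leq_{\mathrm T}Z$, a code for an $h$-Demuth test relative to $Z$ is a coded $h$-r.e. function $g\leq_{\mathrm T}Z$ such that, for all $n$, $e_n=\lim_s g(n,s)$ is an index for which $\Phi^Z_{e_n}$ computes a code for a $\Sigma^{0,Z}_1$ set $\mathcal U_n$ with $\mu(\mathcal U_n)\leq 2^{-n}$. $X$ weakly passes this test if there is an $n$ with $X\notin\mathcal U_n$. $X$ is $h$-weakly Demuth random relative to $Z$ if $X$ weakly passes every $h$-Demuth test relative to $Z$. $h\mbox{-}\mathsf{WDR}$ is the statement ''for every $Z$ there is an $X$ that is $h$-weakly Demuth random relative to $Z$.'' *)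

(* Defs.v *)
From Stdlib Require Import List Arith.
Import ListNotations.

(** * Second-order arithmetic: syntax

    Two-sorted de Bruijn syntax: number variables and set variables are numbered
    independently, [AllN]/[ExN] bind number index 0 and [AllS]/[ExS] bind set
    index 0.  Equality of sets is not a primitive. *)

Inductive term : Type :=
| Var (i : nat)
| Zero
| One
| Add (s t : term)
| Mul (s t : term).

Inductive formula : Type :=
| Eq (s t : term)
| Lt (s t : term)
| Mem (t : term) (X : nat)
| Bot
| Imp (f g : formula)
| And (f g : formula)
| Or (f g : formula)
| AllN (f : formula)
| ExN (f : formula)
| AllS (f : formula)
| ExS (f : formula).

Definition Neg (f : formula) : formula := Imp f Bot.
Definition Iff (f g : formula) : formula := And (Imp f g) (Imp g f).

Definition scons {A : Type} (a : A) (s : nat -> A) : nat -> A :=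
  fun i => match i with 0 => a | S j => s j end.

Fixpoint tsubst (s : nat -> term) (t : term) : term :=
  match t with
  | Var i => s i
  | Zero => Zero
  | One => One
  | Add t1 t2 => Add (tsubst s t1) (tsubst s t2)
  | Mul t1 t2 => Mul (tsubst s t1) (tsubst s t2)
  end.

Definition tlift (t : term) : term := tsubst (fun i => Var (S i)) t.

(** Simultaneous substitution of terms for number variables and of set variables
    for set variables (the set sort has no other terms). *)
Fixpoint subst (s : nat -> term) (r : nat -> nat) (f : formula) : formula :=
  match f with
  | Eq t u => Eq (tsubst s t) (tsubst s u)
  | Lt t u => Lt (tsubst s t) (tsubst s u)
  | Mem t X => Mem (tsubst s t) (r X)
  | Bot => Bot
  | Imp g h => Imp (subst s r g) (subst s r h)
  | And g h => And (subst s r g) (subst s r h)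
  | Or g h => Or (subst s r g) (subst s r h)
  | AllN g => AllN (subst (scons (Var 0) (fun i => tlift (s i))) r g)
  | ExN g => ExN (subst (scons (Var 0) (fun i => tlift (s i))) r g)
  | AllS g => AllS (subst s (scons 0 (fun X => S (r X))) g)
  | ExS g => ExS (subst s (scons 0 (fun X => S (r X))) g)
  end.

Definition liftN (f : formula) : formula :=
  subst (fun i => Var (S i)) (fun X => X) f.
Definition liftS (f : formula) : formula := subst Var S f.
Definition instN (t : term) (f : formula) : formula :=
  subst (scons t Var) (fun X => X) f.
Definition instS (Y : nat) (f : formula) : formula :=
  subst Var (scons Y (fun X => X)) f.

(** Strict upper bounds on the indices of the free number and set variables. *)
Fixpoint tfv (t : term) : nat :=
  match t with
  | Var i => S i
  | Zero | One => 0
  | Add s u | Mul s u => Nat.max (tfv s) (tfv u)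
  end.

Fixpoint fvN (f : formula) : nat :=
  match f with
  | Eq s t | Lt s t => Nat.max (tfv s) (tfv t)
  | Mem t _ => tfv t
  | Bot => 0
  | Imp g h | And g h | Or g h => Nat.max (fvN g) (fvN h)
  | AllN g | ExN g => Nat.pred (fvN g)
  | AllS g | ExS g => fvN g
  end.

Fixpoint fvS (f : formula) : nat :=
  match f with
  | Eq _ _ | Lt _ _ | Bot => 0
  | Mem _ X => S X
  | Imp g h | And g h | Or g h => Nat.max (fvS g) (fvS h)
  | AllN g | ExN g => fvS g
  | AllS g | ExS g => Nat.pred (fvS g)
  end.

Definition universal_closure (f : formula) : formula :=
  Nat.iter (fvS f) AllS (Nat.iter (fvN f) AllN f).

Inductive delta00 : formula -> Prop :=
| d_eq s t : delta00 (Eq s t)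
| d_lt s t : delta00 (Lt s t)
| d_mem t X : delta00 (Mem t X)
| d_bot : delta00 Bot
| d_imp f g : delta00 f -> delta00 g -> delta00 (Imp f g)
| d_and f g : delta00 f -> delta00 g -> delta00 (And f g)
| d_or f g : delta00 f -> delta00 g -> delta00 (Or f g)
| d_all t f : delta00 f -> delta00 (AllN (Imp (Lt (Var 0) (tlift t)) f))
| d_ex t f : delta00 f -> delta00 (ExN (And (Lt (Var 0) (tlift t)) f)).

Definition sigma01 (f : formula) : Prop := exists g, delta00 g /\ f = ExN g.
Definition pi01 (f : formula) : Prop := exists g, delta00 g /\ f = AllN g.

(** * Provability: classical natural deduction for the two-sorted language *)

Inductive prv : list formula -> formula -> Prop :=
| p_ax G f : In f G -> prv G f
| p_raa G f : prv (Neg f :: G) Bot -> prv G f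
| p_impI G f g : prv (f :: G) g -> prv G (Imp f g)
| p_impE G f g : prv G (Imp f g) -> prv G f -> prv G g
| p_andI G f g : prv G f -> prv G g -> prv G (And f g)
| p_andE1 G f g : prv G (And f g) -> prv G f
| p_andE2 G f g : prv G (And f g) -> prv G g
| p_orI1 G f g : prv G f -> prv G (Or f g)
| p_orI2 G f g : prv G g -> prv G (Or f g)
| p_orE G f g k : prv G (Or f g) -> prv (f :: G) k -> prv (g :: G) k -> prv G k
| p_allNI G f : prv (map liftN G) f -> prv G (AllN f)
| p_allNE G f t : prv G (AllN f) -> prv G (instN t f)
| p_exNI G f t : prv G (instN t f) -> prv G (ExN f)
| p_exNE G f k : prv G (ExN f) -> prv (f :: map liftN G) (liftN k) -> prv G k
| p_allSI G f : prv (map liftS G) f -> prv G (AllS f)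
| p_allSE G f Y : prv G (AllS f) -> prv G (instS Y f)
| p_exSI G f Y : prv G (instS Y f) -> prv G (ExS f)
| p_exSE G f k : prv G (ExS f) -> prv (f :: map liftS G) (liftS k) -> prv G k
| p_refl G t : prv G (Eq t t)
| p_eq G f s t : prv G (Eq s t) -> prv G (instN s f) -> prv G (instN t f).

Definition theory : Type := formula -> Prop.

Definition proves (T : theory) (f : formula) : Prop :=
  exists G, (forall g, In g G -> T g) /\ prv G f.

Definition add_axiom (T : theory) (f : formula) : theory := fun g => T g \/ g = f.

(** * Semantics *)

Record structure : Type := {
  dom : Type;
  zero_of : dom;
  one_of : dom;
  add_of : dom -> dom -> dom;
  mul_of : dom -> dom -> dom;
  lt_of : dom -> dom -> Prop;
  sets_of : (dom -> Prop) -> Prop }.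

Fixpoint eval (M : structure) (v : nat -> dom M) (t : term) : dom M :=
  match t with
  | Var i => v i
  | Zero => zero_of M
  | One => one_of M
  | Add s u => add_of M (eval M v s) (eval M v u)
  | Mul s u => mul_of M (eval M v s) (eval M v u)
  end.

Fixpoint sat (M : structure) (v : nat -> dom M) (V : nat -> dom M -> Prop)
    (f : formula) : Prop :=
  match f with
  | Eq s t => eval M v s = eval M v t
  | Lt s t => lt_of M (eval M v s) (eval M v t)
  | Mem t X => V X (eval M v t)
  | Bot => False
  | Imp g h => sat M v V g -> sat M v V h
  | And g h => sat M v V g /\ sat M v V h
  | Or g h => sat M v V g \/ sat M v V h
  | AllN g => forall a, sat M (scons a v) V g
  | ExN g => exists a, sat M (scons a v) V g
  | AllS g => forall A, sets_of M A -> sat M v (scons A V) g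
  | ExS g => exists A, sets_of M A /\ sat M v (scons A V) g
  end.

(** Used for sentences only, where the valuations play no role. *)
Definition holds (M : structure) (f : formula) : Prop := forall v V, sat M v V f.

Definition models (M : structure) (T : theory) : Prop :=
  forall f, T f -> holds M f.

Definition omega (S : (nat -> Prop) -> Prop) : structure :=
  {| dom := nat; zero_of := 0; one_of := 1; add_of := Nat.add; mul_of := Nat.mul;
     lt_of := lt; sets_of := S |}.

(** * Writing formulas with named binders

    An [hform] is a formula that still awaits the number of number and set
    binders above it; a bound variable is known by its binding depth, and turns
    itself into the right de Bruijn index wherever it is used. *)

Definition hterm : Type := nat -> term.
Definition hset : Type := nat -> nat.
Definition hform : Type := nat -> nat -> formula.

Definition hallN (F : hterm -> hform) : hform :=
  fun d e => AllN (F (fun d' => Var (d' - S d)) (S d) e).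
Definition hexN (F : hterm -> hform) : hform :=
  fun d e => ExN (F (fun d' => Var (d' - S d)) (S d) e).
Definition hallS (F : hset -> hform) : hform :=
  fun d e => AllS (F (fun e' => e' - S e) d (S e)).
Definition hexS (F : hset -> hform) : hform :=
  fun d e => ExS (F (fun e' => e' - S e) d (S e)).

Definition hzero : hterm := fun _ => Zero.
Definition hone : hterm := fun _ => One.
Definition hadd (s t : hterm) : hterm := fun d => Add (s d) (t d).
Definition hmul (s t : hterm) : hterm := fun d => Mul (s d) (t d).
Definition heq (s t : hterm) : hform := fun d _ => Eq (s d) (t d).
Definition hlt (s t : hterm) : hform := fun d _ => Lt (s d) (t d).
Definition hmem (t : hterm) (X : hset) : hform := fun d e => Mem (t d) (X e).
Definition hneg (F : hform) : hform := fun d e => Neg (F d e).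
Definition himp (F G : hform) : hform := fun d e => Imp (F d e) (G d e).
Definition hand (F G : hform) : hform := fun d e => And (F d e) (G d e).
Definition hor (F G : hform) : hform := fun d e => Or (F d e) (G d e).
Definition hiff (F G : hform) : hform := fun d e => Iff (F d e) (G d e).

(** [f] with its number variables 0 and 1 instantiated. *)
Definition happ2 (f : formula) (s t : hterm) : hform :=
  fun d _ => subst (scons (s d) (scons (t d) Var)) (fun X => X) f.

Definition sentence (F : hform) : formula := F 0 0.

Declare Scope l2_scope.
Delimit Scope l2_scope with l2.

Notation "'allN' x .. y , F" := (hallN (fun x => .. (hallN (fun y => F)) ..))
  (at level 200, x binder, y binder, right associativity) : l2_scope.
Notation "'exN' x .. y , F" := (hexN (fun x => .. (hexN (fun y => F)) ..))
  (at level 200, x binder, y binder, right associativity) : l2_scope.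
Notation "'allS' x .. y , F" := (hallS (fun x => .. (hallS (fun y => F)) ..))
  (at level 200, x binder, y binder, right associativity) : l2_scope.
Notation "'exS' x .. y , F" := (hexS (fun x => .. (hexS (fun y => F)) ..))
  (at level 200, x binder, y binder, right associativity) : l2_scope.
Notation "0" := hzero : l2_scope.
Notation "1" := hone : l2_scope.
Notation "2" := (hadd hone hone) : l2_scope.
Notation "s + t" := (hadd s t) : l2_scope.
Notation "s * t" := (hmul s t) : l2_scope.
Notation "s = t" := (heq s t) : l2_scope.
Notation "s < t" := (hlt s t) : l2_scope.
Notation "s <= t" := (hor (hlt s t) (heq s t)) : l2_scope.
Notation "t \in X" := (hmem t X) (at level 70, no associativity) : l2_scope.
Notation "~ F" := (hneg F) : l2_scope.
Notation "F --> G" := (himp F G) (at level 90, right associativity) : l2_scope.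
Notation "F <--> G" := (hiff F G) (at level 95, no associativity) : l2_scope.
Notation "F /\ G" := (hand F G) : l2_scope.
Notation "F \/ G" := (hor F G) : l2_scope.

Local Open Scope l2_scope.

(** * The theories RCA0 and WKL0 *)

Definition PA_minus : list formula := map sentence
  [ allN x y z, (x + y) + z = x + (y + z);
    allN x y, x + y = y + x;
    allN x y z, (x * y) * z = x * (y * z);
    allN x y, x * y = y * x;
    allN x y z, x * (y + z) = x * y + x * z;
    allN x, x + 0 = x /\ x * 0 = 0;
    allN x, x * 1 = x;
    allN x y z, x < y /\ y < z --> x < z;
    allN x, ~ x < x;
    allN x y, x < y \/ x = y \/ y < x;
    allN x y z, x < y --> x + z < y + z;
    allN x y z, 0 < z /\ x < y --> x * z < y * z;
    allN x y, x < y --> exN z, x + z = y;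
    0 < 1 /\ allN x, 0 < x --> 1 <= x;
    allN x, 0 <= x ].

(** [f] is a property of number variable 0; the rest are parameters. *)
Definition induction (f : formula) : formula :=
  Imp (And (instN Zero f)
           (AllN (Imp f (subst (scons (Add (Var 0) One) (fun i => Var (S i)))
                               (fun X => X) f))))
      (AllN f).

(** [liftS] makes room for the quantified set, which is thus not free in [f]. *)
Definition comprehension (f g : formula) : formula :=
  Imp (AllN (Iff f g)) (ExS (AllN (Iff (Mem (Var 0) 0) (liftS f)))).

Inductive RCA0 : theory :=
| rca0_basic f : In f PA_minus -> RCA0 f
| rca0_induction f : sigma01 f -> RCA0 (universal_closure (induction f))
| rca0_comprehension f g :
    sigma01 f -> pi01 g -> RCA0 (universal_closure (comprehension f g)).

(** ** Coding: pairs, sequences, finite sets, strings *)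

(** Cantor's pairing bijection: z = <x,y>. *)
Definition isPair (x y z : hterm) : hform :=
  2 * z = (x + y) * (x + y + 1) + 2 * x.

Definition memPair (x y : hterm) (X : hset) : hform :=
  exN z, isPair x y z /\ z \in X.

(** Goedel's beta function: x = a mod (1 + (i + 1) b). *)
Definition isBeta (a b i x : hterm) : hform :=
  (exN q, a = q * (1 + (i + 1) * b) + x) /\ x < 1 + (i + 1) * b.

(** y = 2^x *)
Definition isPow2 (x y : hterm) : hform :=
  exN a b, isBeta a b 0 1 /\
    (allN i, i < x --> exN u, isBeta a b i u /\ isBeta a b (i + 1) (2 * u)) /\
    isBeta a b x y.

(** p is the sum of the F(i) over i < n. *)
Definition isSum (n : hterm) (F : hterm -> hterm -> hform) (p : hterm) : hform :=
  exN a b, isBeta a b 0 0 /\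
    (allN i, i < n -->
       exN u y, F i y /\ isBeta a b i u /\ isBeta a b (i + 1) (u + y)) /\
    isBeta a b n p.

(** Finite sets have canonical indices: c codes the set of the i whose bit in the
    binary expansion of c is 1.  Every number codes a finite set, and every
    element of the set coded by c is < c. *)
Definition inFin (i c : hterm) : hform :=
  exN p q r, isPow2 i p /\ c = (2 * q + 1) * p + r /\ r < p.

Definition isCard (c k : hterm) : hform :=
  isSum c (fun i y => (inFin i c /\ y = 1) \/ (~ inFin i c /\ y = 0)) k.

(** The binary string s of length l is coded by the number one less than the
    number with binary expansion 1s; v is the value of s read in binary, first
    symbol most significant.  Every number codes a string. *)
Definition isStr (s l v : hterm) : hform :=
  exN p, isPow2 l p /\ v < p /\ s + 1 = p + v.

Definition isLen (s l : hterm) : hform := exN v, isStr s l v.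

(** t is an initial segment of s. *)
Definition isPrefix (t s : hterm) : hform :=
  exN l v k w p r, isStr t l v /\ isStr s (l + k) w /\
    isPow2 k p /\ r < p /\ w = v * p + r.

(** s is an initial segment of (the characteristic function of) X. *)
Definition isInitial (s : hterm) (X : hset) : hform :=
  exN l v, isStr s l v /\
    allN i j, i + j + 1 = l --> (i \in X <--> inFin j v).

(** Weak Koenig's lemma; T is a set of codes of strings. *)
Definition isTree (T : hset) : hform :=
  allN s t, s \in T /\ isPrefix t s --> t \in T.
Definition isInfinite (T : hset) : hform := allN n, exN s, n < s /\ s \in T.
Definition isPath (X T : hset) : hform := allN s, isInitial s X --> s \in T.

Definition weak_Koenig : formula := sentence
  (allS T, isTree T /\ isInfinite T --> exS X, isPath X T).

Definition WKL0 : theory := add_axiom RCA0 weak_Koenig.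

(** ** Functions and Turing functionals *)

(** Functions are sets of pairs <argument, value>; binary functions take a pair. *)
Definition isFun (g : hset) : hform :=
  allN x, exN y, memPair x y g /\ allN z, memPair x z g --> z = y.
Definition app (g : hset) (x y : hterm) : hform := memPair x y g.
Definition app2 (g : hset) (n s y : hterm) : hform :=
  exN p, isPair n s p /\ app g p y.

(** The functionals Phi_e are given by Kleene's schemata for the partial recursive
    functions of one variable on top of pairing, with a scheme for the oracle.
    The index <t,<a,b>> stands, according to t, for
      0  zero                       5  x |-> <Phi_a(x), Phi_b(x)>
      1  successor                  6  Phi_a o Phi_b
      2  left projection            7  <x,0> |-> Phi_a(x),
      3  right projection              <x,n+1> |-> Phi_b(<x,<n,Phi_e(<x,n>)>>)
      4  characteristic function    8  x |-> least y with Phi_a(<x,y>) = 0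
         of the oracle
    and for the nowhere defined function when t > 8. *)

(** e = <t,<a,b>> *)
Definition isIndex (t a b e : hterm) : hform := exN c, isPair a b c /\ isPair t c e.

(** The finite set coded by D contains the triple <e,<x,y>>. *)
Definition inComp (D e x y : hterm) : hform :=
  exN p q, isPair x y p /\ isPair e p q /\ inFin q D.

(** D contains all the values that "Phi_e(x) = y" directly depends on. *)
Definition compStep (Z : hset) (D e x y : hterm) : hform :=
  exN t a b, isIndex t a b e /\
  (   (t = 0 /\ y = 0)
   \/ (t = 1 /\ y = x + 1)
   \/ (t = 2 /\ exN r, isPair y r x)
   \/ (t = 2 + 1 /\ exN l, isPair l y x)
   \/ (t = 2 + 2 /\ ((x \in Z /\ y = 1) \/ (~ x \in Z /\ y = 0)))
   \/ (t = 2 + 2 + 1 /\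
         exN u w, inComp D a x u /\ inComp D b x w /\ isPair u w y)
   \/ (t = 2 + 2 + 2 /\ exN u, inComp D b x u /\ inComp D a u y)
   \/ (t = 2 + 2 + 2 + 1 /\
         exN z n, isPair z n x /\
           (   (n = 0 /\ inComp D a z y)
            \/ (exN m u p q r, n = m + 1 /\
                  isPair z m p /\ inComp D e p u /\
                  isPair m u q /\ isPair z q r /\ inComp D b r y)))
   \/ (t = 2 + 2 + 2 + 2 /\
         (exN p, isPair x y p /\ inComp D a p 0) /\
         (allN k, k < y --> exN p u, isPair x k p /\ inComp D a p u /\ 0 < u))).

(** Phi_e^Z(x) = y: some finite set of values closed under [compStep] contains it.
    Justifications cannot be circular, since each step goes to a smaller index or,
    in scheme 7, to the same index and a smaller recursion argument. *)
Definition Phi (Z : hset) (e x y : hterm) : hform :=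
  exN D, inComp D e x y /\
    allN e' x' y', inComp D e' x' y' --> compStep Z D e' x' y'.

Definition Turing_le (Y Z : hset) : hform :=
  exN e, allN n, (n \in Y --> Phi Z e n 1) /\ (~ n \in Y --> Phi Z e n 0).

(** ** Open sets and measure

    An open set is given by a formula U i c, "the i-th finite set of strings of the
    code is the one with canonical index c". *)

Definition inOpen (X : hset) (U : hterm -> hterm -> hform) : hform :=
  exN i c, U i c /\ exN s, inFin s c /\ isInitial s X.

(** s is an element of c without proper initial segments in c. *)
Definition isMinimal (s c : hterm) : hform :=
  inFin s c /\ ~ exN t, inFin t c /\ isPrefix t s /\ ~ t = s.

(** The measure of (the set of strings coded by) c is p / 2^l. *)
Definition isMu (c l p : hterm) : hform :=
  isSum c (fun s y =>
    (isMinimal s c /\ exN m k, isLen s m /\ m + k = l /\ isPow2 k y) \/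
    (~ isMinimal s c /\ y = 0)) p.

(** The measure of c is at most 2^-n. *)
Definition muFinLe (c n : hterm) : hform :=
  exN l p q r, isMu c l p /\ isPow2 n q /\ isPow2 l r /\ p * q <= r.

(** The measure of the open set U is at most 2^-n. *)
Definition muLe (U : hterm -> hterm -> hform) (n : hterm) : hform :=
  allN m, exN c, muFinLe c n /\
    allN s, inFin s c <--> exN i b, i <= m /\ U i b /\ inFin s b.

(** ** The principles MLR and h-WDR *)

Definition MLtest (B Z : hset) : hform :=
  isFun B /\ Turing_le B Z /\ allN n, muLe (fun i c => app2 B n i c) n.

Definition MLrandom (X Z : hset) : hform :=
  allS B, MLtest B Z --> ~ allN n, inOpen X (fun i c => app2 B n i c).

Definition MLR : formula := sentence (allS Z, exS X, MLrandom X Z).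

(** g(n,s) <> g(n,s+1) *)
Definition isChange (g : hset) (n s : hterm) : hform :=
  exN u v, app2 g n s u /\ app2 g n (s + 1) v /\ ~ u = v.

Definition isHre (h : formula) (g : hset) : hform :=
  isFun g /\
  allN n, exN c k m, (allN s, inFin s c <--> isChange g n s) /\
    isCard c k /\ happ2 h n m /\ k <= m.

(** e is the limit of g(n,s) as s tends to infinity. *)
Definition isLim (g : hset) (n e : hterm) : hform :=
  exN s0, allN s, s0 <= s --> app2 g n s e.

Definition DemuthTest (h : formula) (g Z : hset) : hform :=
  isHre h g /\ Turing_le g Z /\
  allN n, exN e, isLim g n e /\
    (allN i, exN c, Phi Z e i c) /\ muLe (fun i c => Phi Z e i c) n.

Definition weakly_passes (X g Z : hset) : hform :=
  exN n e, isLim g n e /\ ~ inOpen X (fun i c => Phi Z e i c).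

Definition weakly_Demuth_random (h : formula) (X Z : hset) : hform :=
  allS g, DemuthTest h g Z --> weakly_passes X g Z.

(** The formula [h], in number variables 0 and 1, expresses "h(n) = m". *)
Definition WDR (h : formula) : formula := sentence
  (allS Z, exS X, weakly_Demuth_random h X Z).

Local Close Scope l2_scope.

(** * Provably total functions and domination *)

Definition provably_total (theta : formula) : Prop :=
  proves RCA0 (sentence
    (allN n, exN m, happ2 theta n m /\ allN k, happ2 theta n k --> k = m)%l2).

(** [theta(n,m)], a parameter-free Sigma^0_1 formula, defines [h] in the standard
    model and provably in RCA0 defines a total function. *)
Definition provably_total_def (theta : formula) (h : nat -> nat) : Prop :=
  sigma01 theta /\ fvN theta <= 2 /\ fvS theta = 0 /\
  (forall n m v V,
     sat (omega (fun _ => True)) (scons n (scons m v)) V theta <-> h n = m) /\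
  provably_total theta.

Definition eventually_dominates (f g : nat -> nat) : Prop :=
  exists n, forall m, n < m -> g m < f m.

(* Main.v *)
From Stdlib Require Import List Arith Lia ClassicalEpsilon.
From Stdlib Require Import FunctionalExtensionality PropExtensionality.
Require Import Defs.
Import ListNotations.

(** Call [X] a column of [A] if [X] is one of the sets [A(2^e (2j + 1) - 1)], [j] running.
    There is a closed class of sets [A] whose columns form a Scott set that also contains,
    for each of its members, a set random relative to that member: the requirements
    "separate two given Sigma^0_1 properties", "be a path through column i" and "be random
    relative to column i" are closed, and each of them can be met by a new column whatever
    the earlier columns are.  So column 0 may be any set [Z].  For such a [Z], let [A_t] be
    the leftmost member of the class whose column 0 agrees with [Z] below [t]; these move to
    the right as [t] grows, so the first [m] bits of [A_t] change fewer than [2^m] times, and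
    their limit [A] is in the class and has [Z] as column 0.  Since the first [n] bits of
    column [e] lie among the first [2^e (2n + 1)] bits of [A], they are approximated with at
    most [k^n] changes for some [k], and the singletons formed by these approximations are
    an [h]-Demuth test that the column does not weakly pass, once the finitely many [n] at
    which [h] is too small are dealt with by starting the approximation late.

    That these tests are computable in [Z] costs nothing: [A_t] depends only on [Z] below
    [t], so [Z] can be defined by recursion so as to contain all of them as sections.  *)

(** * Substitution, coincidence and soundness *)

Lemma eval_tsubst M v s t :
  eval M v (tsubst s t) = eval M (fun i => eval M v (s i)) t.
Proof. induction t; simpl; congruence. Qed.

Lemma eval_scons_lift M a v s :
  (fun i => eval M (scons a v) (scons (Var 0) (fun i => tlift (s i)) i))
  = scons a (fun i => eval M v (s i)).
Proof.
  apply functional_extensionality; intros [|i]; simpl; auto.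
  unfold tlift; now rewrite eval_tsubst.
Qed.

Lemma scons_comp_lift {A} (a : A) V (r : nat -> nat) :
  (fun X => scons a V (scons 0 (fun X => S (r X)) X)) = scons a (fun X => V (r X)).
Proof. now apply functional_extensionality; intros [|i]. Qed.

Lemma sat_subst M f : forall v V s r,
  sat M v V (subst s r f) <-> sat M (fun i => eval M v (s i)) (fun X => V (r X)) f.
Proof.
  induction f; intros; simpl; rewrite ?eval_tsubst; try tauto;
    try (rewrite IHf1, IHf2; tauto).
  - split; intros H a; specialize (H a); rewrite IHf, eval_scons_lift in *; auto.
  - split; intros [a H]; exists a; rewrite IHf, eval_scons_lift in *; auto.
  - split; intros H a Ha; specialize (H a Ha); rewrite IHf, scons_comp_lift in *; auto.
  - split; intros [a [Ha H]]; exists a; rewrite IHf, scons_comp_lift in *; auto.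
Qed.

Lemma eval_coincidence M v v' t :
  (forall i, i < tfv t -> v i = v' i) -> eval M v t = eval M v' t.
Proof.
  induction t; simpl; intros H; auto;
    rewrite IHt1, IHt2; auto; intros; apply H; lia.
Qed.

Lemma sat_coincidence M f : forall v v' V V',
  (forall i, i < fvN f -> v i = v' i) -> (forall X, X < fvS f -> V X = V' X) ->
  sat M v V f <-> sat M v' V' f.
Proof.
  induction f; intros v v' V V' Hv HV; simpl in *; try tauto;
    try (rewrite (eval_coincidence M v v' s), (eval_coincidence M v v' t);
         [tauto | intros; apply Hv; lia | intros; apply Hv; lia]);
    try (rewrite (IHf1 v v' V V'), (IHf2 v v' V V');
         [tauto | intros; apply Hv; lia | intros; apply HV; lia
          | intros; apply Hv; lia | intros; apply HV; lia]).
  - rewrite (eval_coincidence M v v' t), (HV X); [tauto | lia | auto].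
  - assert (E : forall a, sat M (scons a v) V f <-> sat M (scons a v') V' f)
      by (intros a; apply IHf; auto; intros [|i] Hi; simpl; auto; apply Hv; lia).
    split; intros H a; apply E, H.
  - assert (E : forall a, sat M (scons a v) V f <-> sat M (scons a v') V' f)
      by (intros a; apply IHf; auto; intros [|i] Hi; simpl; auto; apply Hv; lia).
    split; intros [a H]; exists a; apply E, H.
  - assert (E : forall A, sat M v (scons A V) f <-> sat M v' (scons A V') f)
      by (intros a; apply IHf; auto; intros [|i] Hi; simpl; auto; apply HV; lia).
    split; intros H a Ha; apply E, H, Ha.
  - assert (E : forall A, sat M v (scons A V) f <-> sat M v' (scons A V') f)
      by (intros a; apply IHf; auto; intros [|i] Hi; simpl; auto; apply HV; lia).
    split; intros [a [Ha H]]; exists a; (split; [exact Ha | apply E, H]).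
Qed.

Lemma sat_liftN M v V a f : sat M (scons a v) V (liftN f) <-> sat M v V f.
Proof. unfold liftN; rewrite sat_subst; reflexivity. Qed.

Lemma sat_liftS M v V A f : sat M v (scons A V) (liftS f) <-> sat M v V f.
Proof. unfold liftS; rewrite sat_subst; reflexivity. Qed.

Lemma sat_instN M v V t f :
  sat M v V (instN t f) <-> sat M (scons (eval M v t) v) V f.
Proof.
  unfold instN; rewrite sat_subst.
  replace (fun i => eval M v (scons t Var i)) with (scons (eval M v t) v);
    [reflexivity | now apply functional_extensionality; intros [|i]].
Qed.

Lemma sat_instS M v V Y f : sat M v V (instS Y f) <-> sat M v (scons (V Y) V) f.
Proof.
  unfold instS; rewrite sat_subst.
  replace (fun X => V (scons Y (fun X => X) X)) with (scons (V Y) V);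
    [reflexivity | now apply functional_extensionality; intros [|i]].
Qed.

(** All values of [V] must lie in the second-order part, because [p_allSE] and [p_exSI] instantiate
    with arbitrary set variables. *)
Lemma soundness M G f : prv G f -> forall v V,
  (forall X, sets_of M (V X)) -> (forall g, In g G -> sat M v V g) -> sat M v V f.
Proof.
  induction 1; intros v V HV HG.
  - now apply HG.
  - apply NNPP; intros Hf; apply (IHprv v V HV).
    intros g [<-|Hg]; [exact Hf | now apply HG].
  - intros Hf; apply IHprv; auto; intros k [<-|Hk]; [exact Hf | now apply HG].
  - apply (IHprv1 v V HV HG), (IHprv2 v V HV HG).
  - split; auto.
  - exact (proj1 (IHprv v V HV HG)).
  - exact (proj2 (IHprv v V HV HG)).
  - left; auto.
  - right; auto.
  - destruct (IHprv1 v V HV HG).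
    + apply IHprv2; auto; intros ? [<-|?]; auto.
    + apply IHprv3; auto; intros ? [<-|?]; auto.
  - intros a; apply IHprv; auto.
    intros g Hg; apply in_map_iff in Hg as [g' [<- Hg]]; apply sat_liftN; auto.
  - apply sat_instN, (IHprv v V HV HG).
  - exists (eval M v t); apply sat_instN, IHprv; auto.
  - destruct (IHprv1 v V HV HG) as [a Ha]; apply (sat_liftN M v V a), IHprv2; auto.
    intros g [<-|Hg]; auto.
    apply in_map_iff in Hg as [g' [<- Hg]]; apply sat_liftN; auto.
  - intros A HA; apply IHprv; [intros [|X]; simpl; auto|].
    intros g Hg; apply in_map_iff in Hg as [g' [<- Hg]]; apply sat_liftS; auto.
  - apply sat_instS, (IHprv v V HV HG); auto.
  - exists (V Y); split; auto; apply sat_instS, IHprv; auto.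
  - destruct (IHprv1 v V HV HG) as [A [HA Ha]]; apply (sat_liftS M v V A), IHprv2;
      [intros [|X]; simpl; auto|].
    intros g [<-|Hg]; auto.
    apply in_map_iff in Hg as [g' [<- Hg]]; apply sat_liftS; auto.
  - reflexivity.
  - pose proof (IHprv1 v V HV HG) as E; simpl in E.
    pose proof (IHprv2 v V HV HG) as F; rewrite sat_instN in *; congruence.
Qed.

Lemma proves_sound M T f A :
  models M T -> sets_of M A -> proves T f -> forall v, sat M v (fun _ => A) f.
Proof.
  intros HM HA [G [HG Hf]] v; apply (soundness _ _ _ Hf); auto.
  intros g Hg; apply HM; auto.
Qed.

Lemma sat_iter_AllS M v f n : forall V,
  (forall V', (forall X, X < n -> sets_of M (V' X)) -> sat M v V' f) ->
  sat M v V (Nat.iter n AllS f).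
Proof.
  (* The set bound by the outermost quantifier ends up at the highest of the new indices. The
     equation for the tail of [V'] keeps track of it through the induction. *)
  enough (E : forall V,
    (forall V', (forall X, X < n -> sets_of M (V' X)) ->
       (forall X, V' (n + X) = V X) -> sat M v V' f) ->
    sat M v V (Nat.iter n AllS f)) by auto.
  induction n as [|n IH]; intros V H.
  - apply (H V); auto; intros; lia.
  - intros A HA; apply IH; intros V' H1 H2; apply H.
    + intros X HX; destruct (Nat.eq_dec X n) as [->|]; [|apply H1; lia].
      specialize (H2 0); rewrite Nat.add_0_r in H2; rewrite H2; exact HA.
    + intros X; specialize (H2 (S X)); rewrite Nat.add_succ_r in H2; exact H2.
Qed.

Lemma sat_iter_AllN M V f n :
  (forall v, sat M v V f) -> forall v, sat M v V (Nat.iter n AllN f).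
Proof. induction n; intros H v; simpl; auto. Qed.

Lemma holds_universal_closure M f A :
  sets_of M A ->
  (forall v V, (forall X, sets_of M (V X)) -> sat M v V f) ->
  holds M (universal_closure f).
Proof.
  intros HA H v V; apply sat_iter_AllS; intros V' HV'.
  apply sat_iter_AllN; intros v'.
  (* From index [fvS f] on, [V'] may leave the second-order part; there it is replaced by [A], which
     does not affect the truth of [f]. *)
  rewrite (sat_coincidence M f v' v' V'
             (fun X => if X <? fvS f then V' X else A)).
  - apply H; intros X; destruct (X <? fvS f) eqn:E; auto.
    apply HV', Nat.ltb_lt, E.
  - auto.
  - intros X HX; apply Nat.ltb_lt in HX; rewrite HX; auto.
Qed.

(** * Absoluteness and use of bounded formulas *)

(** A bounded formula has no set quantifiers, so its evaluation never consults the second-order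
    part. Hence the formula for [h] means the same in all omega-models. *)
Lemma delta00_sat_sets S S' f : delta00 f -> forall v V,
  sat (omega S) v V f <-> sat (omega S') v V f.
Proof.
  assert (E : forall v t, eval (omega S) v t = eval (omega S') v t)
    by (induction t; simpl in *; congruence).
  induction 1; intros v V; cbn [sat omega lt_of eval dom] in *; rewrite ?E;
    try tauto; try (rewrite ?IHdelta00_1, ?IHdelta00_2; tauto).
  - split; intros H1 a; specialize (H1 a); rewrite IHdelta00, E in *; auto.
  - split; intros [a H1]; exists a; rewrite IHdelta00, E in *; auto.
Qed.

Lemma bounded_choice_max (P : nat -> nat -> Prop) n :
  (forall a, a < n -> exists u, forall u', u <= u' -> P a u') ->
  exists u, forall a, a < n -> forall u', u <= u' -> P a u'.
Proof.
  induction n as [|n IH]; intros H; [exists 0; intros; lia|].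
  destruct IH as [u Hu]; [intros; apply H; lia|].
  destruct (H n) as [w Hw]; [lia|].
  exists (Nat.max u w); intros a Ha u' Hu'.
  destruct (Nat.eq_dec a n) as [->|]; [apply Hw | apply Hu]; lia.
Qed.

(** Bounded quantifiers range over finitely many numbers, so finitely many membership questions
    decide the formula. This is what makes the separation requirements closed. *)
Lemma delta00_use S f : delta00 f -> forall v (V : nat -> nat -> Prop),
  exists u, forall u', u <= u' -> forall V' : nat -> nat -> Prop,
    (forall X n, X < u' -> n < u' -> V X n <-> V' X n) ->
    sat (omega S) v V f <-> sat (omega S) v V' f.
Proof.
  induction 1; intros v V.
  1, 2, 4: exists 0; intros; simpl; tauto.
  2-4: destruct (IHdelta00_1 v V) as [u1 H1], (IHdelta00_2 v V) as [u2 H2];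
    exists (Nat.max u1 u2); intros u' Hu' V' HV; simpl;
    rewrite (H1 u'), (H2 u') by (auto; lia); tauto.
  - exists (Datatypes.S (Nat.max X (eval (omega S) v t))); intros u' Hu' V' H.
    simpl; apply H; lia.
  - destruct (bounded_choice_max (fun a u => forall V' : nat -> nat -> Prop,
      (forall X n, X < u -> n < u -> V X n <-> V' X n) ->
      sat (omega S) (scons a v) V f <-> sat (omega S) (scons a v) V' f)
      (eval (omega S) v t)) as [u Hu]; [intros a _; apply IHdelta00|].
    exists u; intros u' Hu' V' HV; cbn [sat]; split; intros Hs a Ha;
      generalize Ha; simpl in Ha; unfold tlift in Ha; rewrite eval_tsubst in Ha;
      intros Ha'; apply (Hu a Ha u' Hu' V' HV), Hs, Ha'.
  - destruct (bounded_choice_max (fun a u => forall V' : nat -> nat -> Prop,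
      (forall X n, X < u -> n < u -> V X n <-> V' X n) ->
      sat (omega S) (scons a v) V f <-> sat (omega S) (scons a v) V' f)
      (eval (omega S) v t)) as [u Hu]; [intros a _; apply IHdelta00|].
    exists u; intros u' Hu' V' HV; cbn [sat]; split; intros [a [Ha Hs]]; exists a;
      (split; [exact Ha|]);
      simpl in Ha; unfold tlift in Ha; rewrite eval_tsubst in Ha;
      apply (Hu a Ha u' Hu' V' HV), Hs.
Qed.

(** * Pairs, sequences and finite sums *)

Fixpoint tri (n : nat) : nat := match n with 0 => 0 | S m => S m + tri m end.
Definition pr (x y : nat) : nat := tri (x + y) + x.

Lemma tri_double n : 2 * tri n = n * (n + 1).
Proof. induction n; cbn [tri]; nia. Qed.

Lemma pr_spec x y z : 2 * z = (x + y) * (x + y + 1) + 2 * x <-> z = pr x y.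
Proof. unfold pr; rewrite <- tri_double; lia. Qed.

Lemma tri_le m n : m <= n -> tri m <= tri n.
Proof. induction 1; cbn [tri]; lia. Qed.

Lemma pr_inj x y x' y' : pr x y = pr x' y' -> x = x' /\ y = y'.
Proof.
  unfold pr; intros H.
  assert (E : x + y = x' + y').
  { destruct (lt_eq_lt_dec (x + y) (x' + y')) as [[L|E]|L]; auto;
      apply tri_le in L; cbn [tri] in L; lia. }
  rewrite E in H; lia.
Qed.

Lemma pr_surj z : exists x y, z = pr x y.
Proof.
  unfold pr; induction z as [|z [x [[|y] IH]]].
  - exists 0, 0; reflexivity.
  - exists 0, (S x); rewrite Nat.add_0_r in IH; simpl; lia.
  - exists (S x), y; replace (S x + y) with (x + S y) by lia; lia.
Qed.

Lemma le_tri n : n <= tri n.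
Proof. induction n; cbn [tri]; lia. Qed.

Lemma pr_le_l x y : x <= pr x y.
Proof. unfold pr; lia. Qed.

Lemma pr_le_r x y : y <= pr x y.
Proof. unfold pr; pose proof (le_tri (x + y)); lia. Qed.

Lemma pr_lt_r x y : 0 < x -> y < pr x y.
Proof. unfold pr; pose proof (le_tri (x + y)); lia. Qed.

(** Course-of-values recursion with choice. The auxiliary [s n] carries the first [n] values and the
    default [b0] elsewhere; as [R] looks only below [n], the choice made from [s n] is also right
    for the finished sequence. *)
Lemma strong_recursion {B : Type} (b0 : B) (R : (nat -> B) -> nat -> B -> Prop) :
  (forall y y' n b, (forall i, i < n -> y i = y' i) -> R y n b -> R y' n b) ->
  (forall y n, exists b, R y n b) ->
  exists y, forall n, R y n (y n).
Proof.
  intros Hext Hex.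
  pose (c y n := proj1_sig (constructive_indefinite_description _ (Hex y n))).
  assert (Hc : forall y n, R y n (c y n))
    by (intros; apply (proj2_sig (constructive_indefinite_description _ (Hex y n)))).
  pose (s := fix s n := match n with
    | 0 => fun _ => b0
    | S m => fun i => if i =? m then c (s m) m else s m i end).
  assert (Hs : forall n m, n < m -> s m n = c (s n) n).
  { intros n m; induction m as [|m IH]; intros H; [lia|]; simpl.
    destruct (Nat.eqb_spec n m) as [->|]; [reflexivity | apply IH; lia]. }
  exists (fun n => c (s n) n); intros n.
  apply (Hext (s n)); [|apply Hc]; intros i Hi; auto.
Qed.

(** * The beta function and sequences of partial results *)

Definition beta (a b i : nat) : nat := a mod (1 + (i + 1) * b).

Lemma beta_spec a b i x :
  ((exists q, a = q * (1 + (i + 1) * b) + x) /\ x < 1 + (i + 1) * b) <-> x = beta a b i.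
Proof.
  unfold beta; split.
  - intros [[q ->] H]; rewrite Nat.add_comm, Nat.Div0.mod_add, Nat.mod_small; auto.
  - intros ->; split; [|apply Nat.mod_upper_bound; lia].
    exists (a / (1 + (i + 1) * b)).
    rewrite Nat.mul_comm; apply Nat.div_mod; lia.
Qed.

Fixpoint prod_below (m : nat -> nat) (n : nat) : nat :=
  match n with 0 => 1 | S k => prod_below m k * m k end.

Lemma gcd_mul_1 a b c : Nat.gcd a c = 1 -> Nat.gcd b c = 1 -> Nat.gcd (a * b) c = 1.
Proof.
  intros H1 H2.
  assert (D : Nat.divide (Nat.gcd (a * b) c) 1).
  { rewrite <- H2; apply Nat.gcd_greatest; [|apply Nat.gcd_divide_r].
    apply (Nat.gauss _ a); [apply Nat.gcd_divide_l|].
    apply Nat.divide_1_r; rewrite <- H1; apply Nat.gcd_greatest.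
    - apply Nat.gcd_divide_r.
    - eapply Nat.divide_trans; [apply Nat.gcd_divide_l | apply Nat.gcd_divide_r]. }
  now apply Nat.divide_1_r in D.
Qed.

Lemma chinese_remainder (m f : nat -> nat) n :
  (forall i j, i < j < n -> Nat.gcd (m i) (m j) = 1) ->
  (forall i, i < n -> f i < m i) ->
  exists a, forall i, i < n -> a mod m i = f i.
Proof.
  induction n as [|n IH]; intros Hm Hf; [exists 0; intros; lia|].
  destruct IH as [a Ha]; [intros; apply Hm; lia | intros; apply Hf; lia|].
  set (N := prod_below m n).
  assert (HN : forall k, k <= n -> Nat.gcd (prod_below m k) (m n) = 1).
  { induction k; intros Hk; simpl; [reflexivity|].
    apply gcd_mul_1; [apply IHk; lia | apply Hm; lia]. }
  assert (HD : forall k i, i < k -> exists q, prod_below m k = q * m i).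
  { induction k; intros i Hi; [lia|]; simpl.
    destruct (Nat.eq_dec i k) as [->|]; [eauto|].
    destruct (IHk i) as [q ->]; [lia|]. exists (q * m k); lia. }
  specialize (HN n (le_n n)); fold N in HN.
  assert (Hpos : N <> 0).
  { unfold N; enough (forall k, k <= n -> prod_below m k <> 0) by auto.
    induction k; intros Hk; simpl; [lia|].
    specialize (Hf k); apply Nat.neq_mul_0; split; [apply IHk|]; lia. }
  destruct (Nat.gcd_bezout_pos N (m n)) as [u [v Huv]]; [lia|]; rewrite HN in Huv.
  (* By Bezout [u * N] is 1 modulo [m n], and [f n + (m n - 1) * a] is [f n - a] modulo [m n],
     written without subtraction. The correction is a multiple of [N], so the earlier residues
     stay. *)
  exists (a + N * (u * (f n + (m n - 1) * a))); intros i Hi.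
  assert (Hmi : m i <> 0) by (specialize (Hf i Hi); lia).
  destruct (Nat.eq_dec i n) as [->|].
  - replace (a + N * (u * (f n + (m n - 1) * a)))
      with (f n + (a + v * (f n + (m n - 1) * a)) * m n).
    + rewrite Nat.Div0.mod_add; apply Nat.mod_small, Hf; lia.
    + replace (N * (u * (f n + (m n - 1) * a)))
        with ((u * N) * (f n + (m n - 1) * a)) by ring.
      rewrite Huv; destruct (m n) as [|k]; [lia|]; simpl (S k - 1).
      rewrite Nat.sub_0_r; ring.
  - destruct (HD n i) as [q Hq]; [lia|]; unfold N; rewrite Hq.
    replace (a + q * m i * (u * (f n + (m n - 1) * a)))
      with (a + q * (u * (f n + (m n - 1) * a)) * m i) by ring.
    rewrite Nat.Div0.mod_add; apply Ha; lia.
Qed.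

Lemma fact_divide k n : 0 < k <= n -> Nat.divide k (fact n).
Proof.
  induction n; intros H; [lia|]; cbn [fact].
  destruct (Nat.eq_dec k (S n)) as [->|].
  - exists (fact n); lia.
  - destruct IHn as [q Hq]; [lia|]; exists ((S n) * q); rewrite Hq; lia.
Qed.

(** A common divisor [g] of the moduli divides [(j - i) * b] and is coprime to [b], so it divides
    [j - i]. But [j - i] divides [b], whence [g] divides [b] as well and is 1. *)
Lemma beta_moduli_coprime b n i j :
  (forall k, 0 < k <= n -> Nat.divide k b) -> i < j <= n ->
  Nat.gcd (1 + (i + 1) * b) (1 + (j + 1) * b) = 1.
Proof.
  intros Hb Hij; set (g := Nat.gcd _ _).
  assert (Hi : Nat.divide g (1 + (i + 1) * b)) by apply Nat.gcd_divide_l.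
  assert (Hj : Nat.divide g (1 + (j + 1) * b)) by apply Nat.gcd_divide_r.
  assert (Hd : Nat.divide g ((j - i) * b)).
  { replace ((j - i) * b) with ((1 + (j + 1) * b) - (1 + (i + 1) * b)) by nia.
    now apply Nat.divide_sub_r. }
  assert (H1 : forall d, Nat.divide d g -> Nat.divide d b -> d = 1).
  { intros d D1 D2; apply Nat.divide_1_r.
    replace 1 with (1 + (i + 1) * b - (i + 1) * b) by lia.
    apply Nat.divide_sub_r; [exact (Nat.divide_trans _ _ _ D1 Hi) | now apply Nat.divide_mul_r]. }
  apply H1; [apply Nat.divide_refl|].
  apply (Nat.divide_trans _ (j - i)); [|apply Hb; lia].
  apply (Nat.gauss _ b); [rewrite Nat.mul_comm; exact Hd|].
  apply H1; [apply Nat.gcd_divide_l | apply Nat.gcd_divide_r].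
Qed.

(* Goedel's beta lemma: b = M! makes the moduli coprime and larger than the f i. *)
Lemma beta_exists (f : nat -> nat) n : exists a b, forall i, i <= n -> beta a b i = f i.
Proof.
  assert (HM : exists M, n <= M /\ forall i, i <= n -> f i <= M).
  { induction n as [|n [M [H1 H2]]].
    - exists (f 0); split; [lia|]; intros i Hi; replace i with 0 by lia; auto.
    - exists (Nat.max (S n) (Nat.max M (f (S n)))); split; [lia|].
      intros i Hi; destruct (Nat.eq_dec i (S n)) as [->|]; [lia|].
      specialize (H2 i); lia. }
  destruct HM as [M [HnM HM]].
  destruct (chinese_remainder (fun i => 1 + (i + 1) * fact M) f (S n)) as [a Ha].
  - intros i j Hij; apply (beta_moduli_coprime _ M); [intros; now apply fact_divide | lia].
  - intros i Hi; specialize (HM i).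
    assert (M <= fact M).
    { destruct (Nat.eq_dec M 0) as [->|]; [simpl; lia|].
      apply Nat.divide_pos_le; [apply lt_O_fact | apply fact_divide; lia]. }
    nia.
  - exists a, (fact M); intros i Hi; apply Ha; lia.
Qed.

Fixpoint sum (n : nat) (f : nat -> nat) : nat :=
  match n with 0 => 0 | S k => sum k f + f k end.

Lemma sum_le n f g : (forall i, i < n -> f i <= g i) -> sum n f <= sum n g.
Proof.
  induction n; intros H; simpl; [lia|].
  pose proof (H n); assert (sum n f <= sum n g) by auto; lia.
Qed.

Lemma sum_ext n f g : (forall i, i < n -> f i = g i) -> sum n f = sum n g.
Proof. intros H; apply Nat.le_antisymm; apply sum_le; intros; rewrite H; auto. Qed.

Lemma sum_mul_r n f k : sum n f * k = sum n (fun i => f i * k).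
Proof. induction n; simpl; lia. Qed.

Lemma sum_single n k y : k < n -> sum n (fun i => if i =? k then y else 0) = y.
Proof.
  intros H; assert (E : forall m, sum m (fun i => if i =? k then y else 0)
    = if k <? m then y else 0).
  { induction m; simpl; auto; rewrite IHm.
    destruct (Nat.ltb_spec k m), (Nat.ltb_spec k (S m)), (Nat.eqb_spec m k); lia. }
  rewrite E; destruct (Nat.ltb_spec k n); lia.
Qed.

(** The coded sequence consists of the partial sums; the summands are recovered as its consecutive
    differences. *)
Lemma beta_sum_spec (R : nat -> nat -> Prop) n p :
  (exists a b, 0 = beta a b 0 /\
     (forall i, i < n -> exists u y, R i y /\ u = beta a b i /\ u + y = beta a b (i + 1)) /\
     p = beta a b n) <->
  exists f, (forall i, i < n -> R i (f i)) /\ p = sum n f.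
Proof.
  split.
  - intros [a [b [H0 [HS ->]]]].
    exists (fun i => beta a b (i + 1) - beta a b i); split.
    + intros i Hi; destruct (HS i Hi) as [u [y [Hy [-> E]]]]; rewrite <- E.
      now replace (beta a b i + y - beta a b i) with y by lia.
    + enough (E : forall k, k <= n ->
        beta a b k = sum k (fun i => beta a b (i + 1) - beta a b i)) by auto.
      induction k; intros Hk; simpl; [auto|]; rewrite <- IHk by lia.
      destruct (HS k) as [u [y [_ [-> E]]]]; [lia|].
      rewrite <- E, <- Nat.add_1_r, <- E; lia.
  - intros [f [Hf ->]]; destruct (beta_exists (fun i => sum i f) n) as [a [b Hab]].
    exists a, b; split; [rewrite Hab; [reflexivity | lia]|]; split.
    + intros i Hi; exists (sum i f), (f i); rewrite !Hab, Nat.add_1_r by lia; auto.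
    + rewrite Hab; auto.
Qed.

Lemma beta_pow2_spec x y :
  (exists a b, 1 = beta a b 0 /\
     (forall i, i < x -> exists u, u = beta a b i /\ 2 * u = beta a b (i + 1)) /\
     y = beta a b x) <-> y = 2 ^ x.
Proof.
  split.
  - intros [a [b [H0 [HS ->]]]].
    enough (E : forall k, k <= x -> beta a b k = 2 ^ k) by auto.
    induction k; intros Hk; [auto|].
    destruct (HS k) as [u [-> E]]; [lia|].
    rewrite Nat.add_1_r in E; rewrite <- E, IHk by lia; reflexivity.
  - intros ->; destruct (beta_exists (Nat.pow 2) x) as [a [b Hab]].
    exists a, b; split; [rewrite Hab; [reflexivity | lia]|]; split.
    + intros i Hi; exists (2 ^ i); rewrite !Hab, Nat.add_1_r by lia; auto.
    + rewrite Hab; auto.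
Qed.

(** * Finite sets as binary expansions *)

Definition bit (i c : nat) : Prop := Nat.testbit c i = true.

Lemma bit_spec i c :
  (exists q r, c = (2 * q + 1) * 2 ^ i + r /\ r < 2 ^ i) <-> bit i c.
Proof.
  unfold bit; rewrite Nat.testbit_true; split.
  - intros [q [r [-> Hr]]].
    rewrite Nat.div_add_l, Nat.div_small, Nat.add_0_r by lia.
    rewrite Nat.add_comm, Nat.mul_comm, Nat.Div0.mod_add; reflexivity.
  - intros H; exists (c / 2 ^ i / 2), (c mod 2 ^ i); split.
    + pose proof (Nat.div_mod (c / 2 ^ i) 2) as E; rewrite H in E; rewrite <- E by lia.
      rewrite Nat.mul_comm; apply Nat.div_mod, Nat.pow_nonzero; lia.
    + apply Nat.mod_upper_bound, Nat.pow_nonzero; lia.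
Qed.

Lemma bit_lt i c : bit i c -> i < c.
Proof.
  unfold bit; intros H; destruct (Nat.lt_ge_cases i c) as [|L]; auto; exfalso.
  destruct (Nat.eq_dec c 0) as [->|]; [rewrite Nat.bits_0 in H; discriminate|].
  rewrite Nat.bits_above_log2 in H; [discriminate|].
  pose proof (Nat.log2_lt_lin c); lia.
Qed.

Lemma bit_comprehension (P : nat -> Prop) N :
  (forall i, P i -> i < N) -> exists c, forall i, bit i c <-> P i.
Proof.
  revert P; induction N as [|N IH]; intros P HP.
  - exists 0; intros i; unfold bit; rewrite Nat.bits_0; split; [discriminate|].
    intros H; apply HP in H; lia.
  - destruct (IH (fun i => P i /\ i < N)) as [c Hc]; [tauto|].
    destruct (classic (P N)) as [H|H].
    + exists (Nat.setbit c N); intros i; unfold bit in *.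
      rewrite Nat.setbit_eqb, Bool.orb_true_iff, Hc, Nat.eqb_eq; split.
      * intros [<-|[]]; auto.
      * intros Hi; specialize (HP i Hi); destruct (Nat.eq_dec N i); [auto|].
        right; split; [auto | lia].
    + exists c; intros i; rewrite Hc; split; [tauto|]; intros Hi; split; auto.
      specialize (HP i Hi); destruct (Nat.eq_dec i N) as [->|]; [tauto | lia].
Qed.

Lemma bit_pow2 s i : bit i (2 ^ s) <-> i = s.
Proof.
  unfold bit; rewrite Nat.pow2_bits_eqb, Nat.eqb_eq; split; auto.
Qed.

(** * Meaning of formulas with named binders *)

(* The binding depths together with the valuation of the variables bound so far. *)
Record env : Type := Env
  { depN : nat; valN : nat -> nat; depS : nat; valS : nat -> nat -> Prop }.

Definition pushN (a : nat) (E : env) : env :=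
  Env (S (depN E)) (scons a (valN E)) (depS E) (valS E).
Definition pushS (A : nat -> Prop) (E : env) : env :=
  Env (depN E) (valN E) (S (depS E)) (scons A (valS E)).

Definition extends (E E' : env) : Prop :=
  depN E <= depN E' /\ depS E <= depS E' /\
  (forall i, valN E' (i + (depN E' - depN E)) = valN E i) /\
  (forall i, valS E' (i + (depS E' - depS E)) = valS E i).

(* A binder-depth-dependent term has to keep its value below any further binders. *)
Definition Den (P : (nat -> Prop) -> Prop) (E : env) (t : hterm) (a : nat) : Prop :=
  forall E', extends E E' -> eval (omega P) (valN E') (t (depN E')) = a.
Definition DenS (E : env) (X : hset) (A : nat -> Prop) : Prop :=
  forall E', extends E E' -> valS E' (X (depS E')) = A.
Definition Sem (P : (nat -> Prop) -> Prop) (E : env) (F : hform) (Q : Prop) : Prop :=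
  sat (omega P) (valN E) (valS E) (F (depN E) (depS E)) <-> Q.
(** For formulas with an open set as parameter: the parameter is used below binders introduced
    later, so its meaning is required in every extension of the environment. *)
Definition Sem2 (P : (nat -> Prop) -> Prop) (E : env) (F : hterm -> hterm -> hform)
    (R : nat -> nat -> Prop) : Prop :=
  forall E' s t a b, extends E E' -> Den P E' s a -> Den P E' t b ->
    Sem P E' (F s t) (R a b).

Lemma extends_refl E : extends E E.
Proof.
  split; [|split; [|split]]; auto; intros i; now rewrite Nat.sub_diag, Nat.add_0_r.
Qed.

Lemma extends_trans E1 E2 E3 : extends E1 E2 -> extends E2 E3 -> extends E1 E3.
Proof.
  intros (A1 & A2 & A3 & A4) (B1 & B2 & B3 & B4).
  split; [|split; [|split]]; [lia | lia | |]; intros i.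
  - rewrite <- A3, <- B3; f_equal; lia.
  - rewrite <- A4, <- B4; f_equal; lia.
Qed.

Lemma extends_pushN a E E' : extends E E' -> extends E (pushN a E').
Proof.
  intros H; apply (extends_trans _ _ _ H); unfold pushN.
  split; [|split; [|split]]; simpl; auto; intros i.
  - replace (i + _) with (S i); [reflexivity | destruct (depN E'); lia].
  - now rewrite Nat.sub_diag, Nat.add_0_r.
Qed.

Lemma extends_pushS A E E' : extends E E' -> extends E (pushS A E').
Proof.
  intros H; apply (extends_trans _ _ _ H); unfold pushS.
  split; [|split; [|split]]; simpl; auto; intros i.
  - now rewrite Nat.sub_diag, Nat.add_0_r.
  - replace (i + _) with (S i); [reflexivity | destruct (depS E'); lia].
Qed.

Lemma Den_extends P E E' t a : Den P E t a -> extends E E' -> Den P E' t a.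
Proof. intros H H1 E2 H2; apply H; eapply extends_trans; eauto. Qed.

Lemma DenS_extends E E' X A : DenS E X A -> extends E E' -> DenS E' X A.
Proof. intros H H1 E2 H2; apply H; eapply extends_trans; eauto. Qed.

Lemma Sem2_extends P E E' F R : Sem2 P E F R -> extends E E' -> Sem2 P E' F R.
Proof. intros H H1 E2 s t a b H2; apply H; eapply extends_trans; eauto. Qed.

Lemma Den_var P E a : Den P (pushN a E) (fun d => Var (d - S (depN E))) a.
Proof. intros E' [_ [_ [H _]]]; exact (H 0). Qed.

Lemma DenS_var E A : DenS (pushS A E) (fun e => e - S (depS E)) A.
Proof. intros E' [_ [_ [_ H]]]; exact (H 0). Qed.

Lemma Den_zero P E : Den P E hzero 0.
Proof. intros E' _; reflexivity. Qed.

Lemma Den_one P E : Den P E hone 1.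
Proof. intros E' _; reflexivity. Qed.

Lemma Den_add P E s t a b : Den P E s a -> Den P E t b -> Den P E (hadd s t) (a + b).
Proof. intros H1 H2 E' H; unfold hadd; simpl; now rewrite (H1 E' H), (H2 E' H). Qed.

Lemma Den_mul P E s t a b : Den P E s a -> Den P E t b -> Den P E (hmul s t) (a * b).
Proof. intros H1 H2 E' H; unfold hmul; simpl; now rewrite (H1 E' H), (H2 E' H). Qed.

Lemma Den_eval P E t a : Den P E t a -> eval (omega P) (valN E) (t (depN E)) = a.
Proof. intros H; apply H, extends_refl. Qed.

Lemma DenS_eval E X A : DenS E X A -> valS E (X (depS E)) = A.
Proof. intros H; apply H, extends_refl. Qed.

Lemma Sem_iff P E F Q Q' : Sem P E F Q -> (Q <-> Q') -> Sem P E F Q'.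
Proof. unfold Sem; tauto. Qed.

Lemma Sem_eq P E s t a b : Den P E s a -> Den P E t b -> Sem P E (heq s t) (a = b).
Proof.
  intros H1 H2; unfold Sem, heq; simpl.
  now rewrite (Den_eval _ _ _ _ H1), (Den_eval _ _ _ _ H2).
Qed.

Lemma Sem_lt P E s t a b : Den P E s a -> Den P E t b -> Sem P E (hlt s t) (a < b).
Proof.
  intros H1 H2; unfold Sem, hlt; simpl.
  now rewrite (Den_eval _ _ _ _ H1), (Den_eval _ _ _ _ H2).
Qed.

Lemma Sem_mem P E t X a A : Den P E t a -> DenS E X A -> Sem P E (hmem t X) (A a).
Proof.
  intros H1 H2; unfold Sem, hmem; simpl.
  now rewrite (Den_eval _ _ _ _ H1), (DenS_eval _ _ _ H2).
Qed.

Lemma Sem_neg P E F Q : Sem P E F Q -> Sem P E (hneg F) (~ Q).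
Proof. unfold Sem, hneg; simpl; tauto. Qed.

Lemma Sem_imp P E F G Q R : Sem P E F Q -> Sem P E G R -> Sem P E (himp F G) (Q -> R).
Proof. unfold Sem, himp; simpl; tauto. Qed.

Lemma Sem_and P E F G Q R : Sem P E F Q -> Sem P E G R -> Sem P E (hand F G) (Q /\ R).
Proof. unfold Sem, hand; simpl; tauto. Qed.

Lemma Sem_or P E F G Q R : Sem P E F Q -> Sem P E G R -> Sem P E (hor F G) (Q \/ R).
Proof. unfold Sem, hor; simpl; tauto. Qed.

Lemma Sem_hiff P E F G Q R : Sem P E F Q -> Sem P E G R -> Sem P E (hiff F G) (Q <-> R).
Proof. unfold Sem, hiff; simpl; tauto. Qed.

Lemma Sem_allN P E F (Q : nat -> Prop) :
  (forall a t, Den P (pushN a E) t a -> Sem P (pushN a E) (F t) (Q a)) ->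
  Sem P E (hallN F) (forall a, Q a).
Proof.
  intros H; split; intros Hs a; specialize (H a _ (Den_var P E a)); apply H, Hs.
Qed.

Lemma Sem_exN P E F (Q : nat -> Prop) :
  (forall a t, Den P (pushN a E) t a -> Sem P (pushN a E) (F t) (Q a)) ->
  Sem P E (hexN F) (exists a, Q a).
Proof.
  intros H; split; intros [a Hs]; exists a; specialize (H a _ (Den_var P E a));
    apply H, Hs.
Qed.

Lemma Sem_allS P E F (Q : (nat -> Prop) -> Prop) :
  (forall A X, DenS (pushS A E) X A -> Sem P (pushS A E) (F X) (Q A)) ->
  Sem P E (hallS F) (forall A, P A -> Q A).
Proof.
  intros H; split; intros Hs A HA; specialize (H A _ (DenS_var E A));
    apply H, (Hs A HA).
Qed.

Lemma Sem_exS P E F (Q : (nat -> Prop) -> Prop) :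
  (forall A X, DenS (pushS A E) X A -> Sem P (pushS A E) (F X) (Q A)) ->
  Sem P E (hexS F) (exists A, P A /\ Q A).
Proof.
  intros H; split; intros [A [HA Hs]]; exists A; (split; [exact HA|]);
    specialize (H A _ (DenS_var E A)); apply H, Hs.
Qed.

Lemma Sem_Sem2 P E F R s t a b :
  Sem2 P E F R -> Den P E s a -> Den P E t b -> Sem P E (F s t) (R a b).
Proof. intros H; apply H, extends_refl. Qed.

Create HintDb sem.

Ltac solve_extends :=
  solve [repeat first [apply extends_refl | eassumption | apply extends_pushN
                      | apply extends_pushS
                      | match goal with H : extends _ ?E |- extends _ ?E =>
                          refine (extends_trans _ _ _ _ H) end]].

Ltac solve_den :=
  lazymatch goal with
  | |- Den _ _ hzero _ => apply Den_zero
  | |- Den _ _ hone _ => apply Den_one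
  | |- Den _ _ (hadd _ _) _ => eapply Den_add; solve_den
  | |- Den _ _ (hmul _ _) _ => eapply Den_mul; solve_den
  | H : Den _ _ ?t _ |- Den _ _ ?t _ => refine (Den_extends _ _ _ _ _ H _); solve_extends
  end.

Ltac solve_denS :=
  lazymatch goal with
  | H : DenS _ ?X _ |- DenS _ ?X _ => refine (DenS_extends _ _ _ _ H _); solve_extends
  end.

Ltac solve_sem2_hyp :=
  lazymatch goal with
  | H : Sem2 _ _ ?F _ |- Sem2 _ _ ?F _ => refine (Sem2_extends _ _ _ _ _ H _); solve_extends
  end.

#[local] Hint Extern 0 (Den _ _ _ _) => solve_den : sem.
#[local] Hint Extern 0 (DenS _ _ _) => solve_denS : sem.
#[local] Hint Extern 0 (Sem2 _ _ _ _) => solve_sem2_hyp : sem.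
#[local] Hint Extern 1 (Sem2 _ _ _ _) => intro : sem.
#[local] Hint Extern 0 (Sem _ _ (heq _ _) _) => eapply Sem_eq : sem.
#[local] Hint Extern 0 (Sem _ _ (hlt _ _) _) => eapply Sem_lt : sem.
#[local] Hint Extern 0 (Sem _ _ (hmem _ _) _) => eapply Sem_mem : sem.
#[local] Hint Extern 0 (Sem _ _ (hneg _) _) => eapply Sem_neg : sem.
#[local] Hint Extern 0 (Sem _ _ (himp _ _) _) => eapply Sem_imp : sem.
#[local] Hint Extern 0 (Sem _ _ (hand _ _) _) => eapply Sem_and : sem.
#[local] Hint Extern 0 (Sem _ _ (hor _ _) _) => eapply Sem_or : sem.
#[local] Hint Extern 0 (Sem _ _ (hiff _ _) _) => eapply Sem_hiff : sem.
#[local] Hint Extern 0 (Sem _ _ (hallN _) _) => eapply Sem_allN; intros : sem.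
#[local] Hint Extern 0 (Sem _ _ (hexN _) _) => eapply Sem_exN; intros : sem.
#[local] Hint Extern 0 (Sem _ _ (hallS _) _) => eapply Sem_allS; intros : sem.
#[local] Hint Extern 0 (Sem _ _ (hexS _) _) => eapply Sem_exS; intros : sem.

(** The search is directed by the syntax of the formula. The proposition in [Sem] may be an
    existential variable, which the search fills with the literal meaning; [Sem_iff] then replaces
    it by a readable one. *)
Ltac sem := solve [eauto 300 with sem nocore].

(** * Strings, computations and measure *)

Definition isstr (s l v : nat) : Prop := v < 2 ^ l /\ s + 1 = 2 ^ l + v.
Definition len (s : nat) : nat := Nat.log2 (s + 1).
Definition prefix (t s : nat) : Prop :=
  exists l v k w r, isstr t l v /\ isstr s (l + k) w /\ r < 2 ^ k /\ w = v * 2 ^ k + r.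

Fixpoint val (m : nat) (x : nat -> bool) : nat :=
  match m with 0 => 0 | S l => 2 * val l x + Nat.b2n (x l) end.

(* The code of the string x(0) ... x(l - 1). *)
Definition str (l : nat) (x : nat -> bool) : nat := Nat.pred (2 ^ l + val l x).

Definition initial (s : nat) (x : nat -> bool) : Prop := exists l, s = str l x.

Definition chi (A : nat -> Prop) (n : nat) : bool :=
  if excluded_middle_informative (A n) then true else false.

Lemma chi_true A n : chi A n = true <-> A n.
Proof. unfold chi; destruct excluded_middle_informative; intuition discriminate. Qed.

Lemma chi_bool x : chi (fun n => x n = true) = x.
Proof.
  apply functional_extensionality; intros n; unfold chi.
  destruct excluded_middle_informative as [H|H]; [auto | now destruct (x n)].
Qed.

Lemma pow2_pos n : 0 < 2 ^ n.
Proof. pose proof (Nat.pow_nonzero 2 n); lia. Qed.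

Lemma val_lt m x : val m x < 2 ^ m.
Proof. induction m; cbn [val Nat.pow]; [lia | destruct (x m); simpl; lia]. Qed.

Lemma str_succ l x : str l x + 1 = 2 ^ l + val l x.
Proof. unfold str; pose proof (pow2_pos l); lia. Qed.

Lemma isstr_str l x : isstr (str l x) l (val l x).
Proof. split; [apply val_lt | apply str_succ]. Qed.

Lemma isstr_len s l v : isstr s l v -> l = len s.
Proof.
  unfold len; intros [H1 H2]; symmetry; rewrite H2.
  apply Nat.log2_unique; [lia | cbn [Nat.pow]; lia].
Qed.

Lemma isstr_exists s : isstr s (len s) (s + 1 - 2 ^ len s).
Proof.
  destruct (Nat.log2_spec (s + 1)) as [H1 H2]; [lia|]; unfold isstr, len.
  cbn [Nat.pow] in H2; lia.
Qed.

Lemma len_str l x : len (str l x) = l.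
Proof. symmetry; eapply isstr_len, isstr_str. Qed.

Lemma val_split x k l : k <= l ->
  exists r, r < 2 ^ (l - k) /\ val l x = val k x * 2 ^ (l - k) + r.
Proof.
  induction 1 as [|l Hl [r [H1 H2]]].
  - exists 0; rewrite Nat.sub_diag; simpl; lia.
  - exists (2 * r + Nat.b2n (x l)); rewrite Nat.sub_succ_l by auto.
    cbn [val Nat.pow]; rewrite H2; split; [destruct (x l); simpl; lia | ring].
Qed.

Lemma prefix_str x k l : k <= l -> prefix (str k x) (str l x).
Proof.
  intros H; destruct (val_split x k l H) as [r [H1 H2]].
  exists k, (val k x), (l - k), (val l x), r.
  replace (k + (l - k)) with l by lia; auto using isstr_str.
Qed.

Lemma euclid_unique q r q' r' b : r < b -> r' < b -> q * b + r = q' * b + r' -> q = q' /\ r = r'.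
Proof.
  intros H1 H2 H; assert (q = q') by (destruct (lt_eq_lt_dec q q') as [[L|L]|L]; nia).
  subst; lia.
Qed.

Lemma prefix_of_str t x l : prefix t (str l x) -> exists k, k <= l /\ t = str k x.
Proof.
  intros (k & v & m & w & r & [Hv Ht] & Hs & Hr & ->).
  pose proof (isstr_len _ _ _ Hs) as E; rewrite len_str in E; subst l.
  exists k; split; [lia|].
  destruct (val_split x k (k + m)) as [r' [H1 H2]]; [lia|].
  replace (k + m - k) with m in * by lia.
  destruct Hs as [_ Hs]; rewrite str_succ in Hs.
  destruct (euclid_unique v r (val k x) r' (2 ^ m)) as [-> _]; auto; [lia|].
  pose proof (str_succ k x); lia.
Qed.

Lemma val_testbit x j : forall i l, i + j + 1 = l -> Nat.testbit (val l x) j = x i.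
Proof.
  induction j as [|j IH]; intros i l <-.
  - replace (i + 0 + 1) with (S i) by lia; cbn [val].
    rewrite Nat.add_comm; apply Nat.add_b2n_double_bit0.
  - replace (i + S j + 1) with (S (i + j + 1)) by lia; cbn [val].
    rewrite Nat.add_comm, <- (IH i _ eq_refl).
    rewrite <- Nat.div2_bits, Nat.add_b2n_double_div2; auto.
Qed.

Lemma bits_of_val x v l : v < 2 ^ l ->
  (forall i j, i + j + 1 = l -> Nat.testbit v j = x i) -> v = val l x.
Proof.
  intros Hv H; apply Nat.bits_inj; intros j.
  destruct (Nat.lt_ge_cases j l) as [L|L].
  - rewrite (val_testbit x j (l - j - 1)), (H (l - j - 1)) by lia; auto.
  - assert (E : forall v, v < 2 ^ l -> Nat.testbit v j = false).
    { intros u Hu; destruct (Nat.eq_dec u 0) as [->|]; [apply Nat.bits_0|].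
      apply Nat.bits_above_log2, Nat.log2_lt_pow2; [lia|].
      eapply Nat.lt_le_trans; [exact Hu | apply Nat.pow_le_mono_r; lia]. }
    rewrite !E; auto using val_lt.
Qed.

(** The first symbol of a string is the most significant bit of its value, hence the reversal of
    positions. *)
Definition bits (l v : nat) (i : nat) : bool := Nat.testbit v (l - i - 1).

Lemma val_bits l v : v < 2 ^ l -> val l (bits l v) = v.
Proof.
  intros H; symmetry; apply bits_of_val; auto; intros i j E; unfold bits; f_equal; lia.
Qed.

Lemma initial_spec s A :
  (exists l v, isstr s l v /\ forall i j, i + j + 1 = l -> (A i <-> bit j v)) <->
  initial s (chi A).
Proof.
  split.
  - intros [l [v [[Hv Hs] H]]]; exists l.
    rewrite (bits_of_val (chi A) v l) in Hs; [pose proof (str_succ l (chi A)); lia | auto|].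
    intros i j E; specialize (H i j E); unfold bit, chi in *.
    destruct excluded_middle_informative as [a|a]; [tauto|].
    destruct (Nat.testbit v j); tauto.
  - intros [l ->]; exists l, (val l (chi A)); split; [apply isstr_str|].
    intros i j E; unfold bit; rewrite (val_testbit (chi A) j i l E), chi_true; tauto.
Qed.

Definition inD (D e x y : nat) : Prop := bit (pr e (pr x y)) D.

Definition step (Z : nat -> Prop) (C : nat -> nat -> nat -> Prop) (e x y : nat) : Prop :=
  exists t a b, e = pr t (pr a b) /\
  (   (t = 0 /\ y = 0)
   \/ (t = 1 /\ y = x + 1)
   \/ (t = 2 /\ exists r, x = pr y r)
   \/ (t = 3 /\ exists l, x = pr l y)
   \/ (t = 4 /\ ((Z x /\ y = 1) \/ (~ Z x /\ y = 0)))
   \/ (t = 5 /\ exists u w, C a x u /\ C b x w /\ y = pr u w)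
   \/ (t = 6 /\ exists u, C b x u /\ C a u y)
   \/ (t = 7 /\ exists z n, x = pr z n /\
         (   (n = 0 /\ C a z y)
          \/ exists m u, n = m + 1 /\ C e (pr z m) u /\ C b (pr z (pr m u)) y))
   \/ (t = 8 /\ C a (pr x y) 0 /\ forall k, k < y -> exists u, C a (pr x k) u /\ 0 < u)).

Definition phi (Z : nat -> Prop) (e x y : nat) : Prop :=
  exists D, inD D e x y /\ forall e' x' y', inD D e' x' y' -> step Z (inD D) e' x' y'.

Definition turing_le (Y Z : nat -> Prop) : Prop :=
  exists e, forall n, (Y n -> phi Z e n 1) /\ (~ Y n -> phi Z e n 0).

Definition isfun (g : nat -> Prop) : Prop :=
  forall x, exists y, g (pr x y) /\ forall z, g (pr x z) -> z = y.

Definition in_open (x : nat -> bool) (R : nat -> nat -> Prop) : Prop :=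
  exists i c, R i c /\ exists s, bit s c /\ initial s x.

Definition minimal (s c : nat) : Prop :=
  bit s c /\ ~ exists t, bit t c /\ prefix t s /\ t <> s.

(** Numerators of the measures $2^{-|s|}$ over the common denominator [2 ^ l]; a string with a
    proper initial segment in [c] adds nothing to the union. *)
Definition weights (c l : nat) (f : nat -> nat) : Prop := forall s, s < c ->
  (minimal s c /\ len s <= l /\ f s = 2 ^ (l - len s)) \/ (~ minimal s c /\ f s = 0).

Definition mu_fin_le (c n : nat) : Prop :=
  exists l f, weights c l f /\ sum c f * 2 ^ n <= 2 ^ l.

Definition mu_le (R : nat -> nat -> Prop) (n : nat) : Prop :=
  forall m, exists c, mu_fin_le c n /\
    forall s, bit s c <-> exists i b, i <= m /\ R i b /\ bit s b.

Definition card (c : nat) : nat := sum c (fun i => Nat.b2n (Nat.testbit c i)).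

(** * The meaning of the coding formulas *)

Lemma ex_eq (Q : nat -> Prop) a : (exists z, z = a /\ Q z) <-> Q a.
Proof. split; [intros [z [-> H]] | intros H; exists a]; auto. Qed.

Lemma Sem_isPair P E s t u a b c :
  Den P E s a -> Den P E t b -> Den P E u c -> Sem P E (isPair s t u) (c = pr a b).
Proof. intros; eapply Sem_iff; [unfold isPair; sem | apply pr_spec]. Qed.
#[local] Hint Extern 0 (Sem _ _ (isPair _ _ _) _) => eapply Sem_isPair : sem.

Lemma Sem_memPair P E s t X a b A :
  Den P E s a -> Den P E t b -> DenS E X A -> Sem P E (memPair s t X) (A (pr a b)).
Proof. intros; eapply Sem_iff; [unfold memPair; sem | apply ex_eq]. Qed.
#[local] Hint Extern 0 (Sem _ _ (memPair _ _ _) _) => eapply Sem_memPair : sem.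

Lemma Sem_isBeta P E s t i u a b j x :
  Den P E s a -> Den P E t b -> Den P E i j -> Den P E u x ->
  Sem P E (isBeta s t i u) (x = beta a b j).
Proof. intros; eapply Sem_iff; [unfold isBeta; sem | apply beta_spec]. Qed.
#[local] Hint Extern 0 (Sem _ _ (isBeta _ _ _ _) _) => eapply Sem_isBeta : sem.

Lemma Sem_isPow2 P E s t x y :
  Den P E s x -> Den P E t y -> Sem P E (isPow2 s t) (y = 2 ^ x).
Proof. intros; eapply Sem_iff; [unfold isPow2; sem | apply beta_pow2_spec]. Qed.
#[local] Hint Extern 0 (Sem _ _ (isPow2 _ _) _) => eapply Sem_isPow2 : sem.

Lemma Sem_isSum P E s F t n R p :
  Den P E s n -> Sem2 P E F R -> Den P E t p ->
  Sem P E (isSum s F t) (exists f, (forall i, i < n -> R i (f i)) /\ p = sum n f).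
Proof.
  intros; eapply Sem_iff; [unfold isSum | apply beta_sum_spec].
  eapply Sem_exN; intros; eapply Sem_exN; intros.
  eapply Sem_and; [sem|]; eapply Sem_and; [|sem].
  eapply Sem_allN; intros; eapply Sem_imp; [sem|].
  eapply Sem_exN; intros; eapply Sem_exN; intros; eapply Sem_and; [|sem].
  eapply Sem_Sem2; [solve_sem2_hyp | solve_den | solve_den].
Qed.
#[local] Hint Extern 0 (Sem _ _ (isSum _ _ _) _) => eapply Sem_isSum : sem.

Lemma Sem_inFin P E s t i c :
  Den P E s i -> Den P E t c -> Sem P E (inFin s t) (bit i c).
Proof.
  intros; eapply Sem_iff; [unfold inFin; sem|]; rewrite <- bit_spec; split.
  - intros [p [q [r [-> H1]]]]; exists q, r; exact H1.
  - intros [q [r H1]]; exists (2 ^ i), q, r; auto.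
Qed.
#[local] Hint Extern 0 (Sem _ _ (inFin _ _) _) => eapply Sem_inFin : sem.

Lemma Sem_isCard P E s t c k :
  Den P E s c -> Den P E t k -> Sem P E (isCard s t) (k = card c).
Proof.
  intros; eapply Sem_iff; [unfold isCard; sem|]; unfold card; split.
  - intros [f [Hf ->]]; apply sum_ext; intros i Hi.
    destruct (Hf i Hi) as [[H1 ->]|[H1 ->]]; unfold bit in H1;
      destruct (Nat.testbit c i); simpl; congruence.
  - intros ->; eexists; split; [|reflexivity]; intros i _; unfold bit; simpl.
    destruct (Nat.testbit c i); auto.
Qed.
#[local] Hint Extern 0 (Sem _ _ (isCard _ _) _) => eapply Sem_isCard : sem.

Lemma Sem_isStr P E t1 t2 t3 s l v :
  Den P E t1 s -> Den P E t2 l -> Den P E t3 v -> Sem P E (isStr t1 t2 t3) (isstr s l v).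
Proof.
  intros; eapply Sem_iff;
    [unfold isStr; sem | exact (ex_eq (fun p => v < p /\ s + 1 = p + v) _)].
Qed.
#[local] Hint Extern 0 (Sem _ _ (isStr _ _ _) _) => eapply Sem_isStr : sem.

Lemma Sem_isLen P E t1 t2 s l :
  Den P E t1 s -> Den P E t2 l -> Sem P E (isLen t1 t2) (l = len s).
Proof.
  intros; eapply Sem_iff; [unfold isLen; sem|]; split.
  - intros [v Hv]; eapply isstr_len; eauto.
  - intros ->; eexists; apply isstr_exists.
Qed.
#[local] Hint Extern 0 (Sem _ _ (isLen _ _) _) => eapply Sem_isLen : sem.

Lemma Sem_isPrefix P E t1 t2 t s :
  Den P E t1 t -> Den P E t2 s -> Sem P E (isPrefix t1 t2) (prefix t s).
Proof.
  intros; eapply Sem_iff; [unfold isPrefix; sem|]; unfold prefix; split.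
  - intros (l & v & k & w & p & r & H1 & H2 & -> & H3 & ->);
    exists l, v, k, (v * 2 ^ k + r), r; auto.
  - intros (l & v & k & w & r & H1 & H2 & H3 & ->);
    exists l, v, k, (v * 2 ^ k + r), (2 ^ k), r; auto.
Qed.
#[local] Hint Extern 0 (Sem _ _ (isPrefix _ _) _) => eapply Sem_isPrefix : sem.

Lemma Sem_isInitial P E t X s A :
  Den P E t s -> DenS E X A -> Sem P E (isInitial t X) (initial s (chi A)).
Proof. intros; eapply Sem_iff; [unfold isInitial; sem | apply initial_spec]. Qed.
#[local] Hint Extern 0 (Sem _ _ (isInitial _ _) _) => eapply Sem_isInitial : sem.

Lemma Sem_isFun P E X A : DenS E X A -> Sem P E (isFun X) (isfun A).
Proof. intros; unfold isFun; sem. Qed.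
#[local] Hint Extern 0 (Sem _ _ (isFun _) _) => eapply Sem_isFun : sem.

Lemma Sem_app2 P E X s t u A a b c :
  DenS E X A -> Den P E s a -> Den P E t b -> Den P E u c ->
  Sem P E (app2 X s t u) (A (pr (pr a b) c)).
Proof. intros; eapply Sem_iff; [unfold app2, app; sem | exact (ex_eq (fun z => A (pr z c)) _)]. Qed.
#[local] Hint Extern 0 (Sem _ _ (app2 _ _ _ _) _) => eapply Sem_app2 : sem.

Lemma Sem_isIndex P E t1 t2 t3 t4 t a b e :
  Den P E t1 t -> Den P E t2 a -> Den P E t3 b -> Den P E t4 e ->
  Sem P E (isIndex t1 t2 t3 t4) (e = pr t (pr a b)).
Proof. intros; eapply Sem_iff; [unfold isIndex; sem | exact (ex_eq (fun z => e = pr t z) _)]. Qed.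
#[local] Hint Extern 0 (Sem _ _ (isIndex _ _ _ _) _) => eapply Sem_isIndex : sem.

Lemma Sem_inComp P E t1 t2 t3 t4 D e x y :
  Den P E t1 D -> Den P E t2 e -> Den P E t3 x -> Den P E t4 y ->
  Sem P E (inComp t1 t2 t3 t4) (inD D e x y).
Proof.
  intros; eapply Sem_iff; [unfold inComp; sem|]; unfold inD; split.
  - intros [p [q [-> [-> H3]]]]; exact H3.
  - intros H3; do 2 eexists; eauto.
Qed.
#[local] Hint Extern 0 (Sem _ _ (inComp _ _ _ _) _) => eapply Sem_inComp : sem.

Lemma Sem_compStep P E X t1 t2 t3 t4 Z D e x y :
  DenS E X Z -> Den P E t1 D -> Den P E t2 e -> Den P E t3 x -> Den P E t4 y ->
  Sem P E (compStep X t1 t2 t3 t4) (step Z (inD D) e x y).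
Proof.
  intros; eapply Sem_iff; [unfold compStep; sem|]; unfold step.
  split; intros (t & a & b & -> & H4); exists t, a, b; (split; [reflexivity|]); revert H4.
  - intros [H4|[H4|[H4|[H4|[H4|[H4|[H4|[H4|H4]]]]]]]]; [tauto|tauto|tauto|tauto|tauto|tauto|tauto| |].
    + destruct H4 as [Ht (z & n & -> & [H4|(m & u & p & q & r & -> & -> & H5 & -> & -> & H6)])];
        do 7 right; left; (split; [exact Ht|]); exists z; [exists n | exists (m + 1)]; eauto 10.
    + destruct H4 as [Ht [(p & -> & H5) H6]]; do 8 right; split; [exact Ht|]; split; auto.
      intros k Hk; destruct (H6 k Hk) as (p & u & -> & H7); eauto.
  - intros [H4|[H4|[H4|[H4|[H4|[H4|[H4|[H4|H4]]]]]]]]; [tauto|tauto|tauto|tauto|tauto|tauto|tauto| |].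
    + destruct H4 as [Ht (z & n & -> & [H4|(m & u & -> & H5 & H6)])];
        do 7 right; left; (split; [exact Ht|]); exists z; [exists n | exists (m + 1)]; eauto 10.
      split; [reflexivity|]; right; exists m, u; do 3 eexists; eauto 10.
    + destruct H4 as [Ht [H5 H6]]; do 8 right; split; [exact Ht|]; split; [eauto|].
      intros k Hk; destruct (H6 k Hk) as (u & H7); eauto.
Qed.
#[local] Hint Extern 0 (Sem _ _ (compStep _ _ _ _ _) _) => eapply Sem_compStep : sem.

Lemma Sem_Phi P E X t1 t2 t3 Z e x y :
  DenS E X Z -> Den P E t1 e -> Den P E t2 x -> Den P E t3 y ->
  Sem P E (Phi X t1 t2 t3) (phi Z e x y).
Proof. intros; unfold Phi; sem. Qed.
#[local] Hint Extern 0 (Sem _ _ (Phi _ _ _ _) _) => eapply Sem_Phi : sem.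

Lemma Sem_Turing_le P E X Y A B :
  DenS E X A -> DenS E Y B -> Sem P E (Turing_le X Y) (turing_le A B).
Proof. intros; unfold Turing_le; sem. Qed.
#[local] Hint Extern 0 (Sem _ _ (Turing_le _ _) _) => eapply Sem_Turing_le : sem.

Lemma Sem_inOpen P E X U A R :
  DenS E X A -> Sem2 P E U R -> Sem P E (inOpen X U) (in_open (chi A) R).
Proof.
  intros; unfold inOpen; eapply Sem_exN; intros; eapply Sem_exN; intros.
  eapply Sem_and; [eapply Sem_Sem2; [solve_sem2_hyp | solve_den | solve_den] | sem].
Qed.
#[local] Hint Extern 0 (Sem _ _ (inOpen _ _) _) => eapply Sem_inOpen : sem.

Lemma Sem_isMinimal P E t1 t2 s c :
  Den P E t1 s -> Den P E t2 c -> Sem P E (isMinimal t1 t2) (minimal s c).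
Proof. intros; unfold isMinimal; sem. Qed.
#[local] Hint Extern 0 (Sem _ _ (isMinimal _ _) _) => eapply Sem_isMinimal : sem.

Lemma Sem_isMu P E t1 t2 t3 c l p :
  Den P E t1 c -> Den P E t2 l -> Den P E t3 p ->
  Sem P E (isMu t1 t2 t3) (exists f, weights c l f /\ p = sum c f).
Proof.
  intros; eapply Sem_iff; [unfold isMu; sem|]; unfold weights; simpl.
  split; intros [f [Hf ->]]; exists f; (split; [|reflexivity]); intros s Hs;
    destruct (Hf s Hs) as [[H2 H3]|H2]; auto; left; split; auto.
  - destruct H3 as (m & k & -> & <- & ->); split; [lia | f_equal; lia].
  - destruct H3 as [H3 ->]; exists (len s), (l - len s); repeat split; lia.
Qed.
#[local] Hint Extern 0 (Sem _ _ (isMu _ _ _) _) => eapply Sem_isMu : sem.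

Lemma Sem_muFinLe P E t1 t2 c n :
  Den P E t1 c -> Den P E t2 n -> Sem P E (muFinLe t1 t2) (mu_fin_le c n).
Proof.
  intros; eapply Sem_iff; [unfold muFinLe; sem|]; unfold mu_fin_le; split.
  - intros (l & p & q & r & [f [Hf ->]] & -> & -> & H1 ); exists l, f; split; auto; lia.
  - intros (l & f & Hf & H1); exists l, (sum c f), (2 ^ n), (2 ^ l).
    repeat split; eauto; lia.
Qed.
#[local] Hint Extern 0 (Sem _ _ (muFinLe _ _) _) => eapply Sem_muFinLe : sem.

Lemma Sem_muLe P E U t R n :
  Sem2 P E U R -> Den P E t n -> Sem P E (muLe U t) (mu_le R n).
Proof.
  intros; eapply Sem_iff.
  - unfold muLe; eapply Sem_allN; intros; eapply Sem_exN; intros.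
    eapply Sem_and; [sem|]; eapply Sem_allN; intros; eapply Sem_hiff; [sem|].
    eapply Sem_exN; intros; eapply Sem_exN; intros; eapply Sem_and; [sem|].
    eapply Sem_and; [|sem]; eapply Sem_Sem2; [solve_sem2_hyp | solve_den | solve_den].
  - unfold mu_le; split; intros H1 m; destruct (H1 m) as [c [H2 H3]]; exists c;
      (split; [exact H2|]); intros s; rewrite H3;
      split; intros (i & b & Hi & H4); exists i, b; (split; [lia | exact H4]).
Qed.
#[local] Hint Extern 0 (Sem _ _ (muLe _ _) _) => eapply Sem_muLe : sem.

(** * Weak König's lemma, [MLR] and [h-WDR] in an omega-model *)

Definition weak_koenig (P : (nat -> Prop) -> Prop) : Prop :=
  forall T, P T ->
    (forall s t, T s /\ prefix t s -> T t) /\ (forall n, exists s, n < s /\ T s) ->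
    exists X, P X /\ forall s, initial s (chi X) -> T s.

Definition ml_test (B Z : nat -> Prop) : Prop :=
  isfun B /\ turing_le B Z /\ forall n, mu_le (fun i c => B (pr (pr n i) c)) n.

Definition ml_randoms (P : (nat -> Prop) -> Prop) : Prop :=
  forall Z, P Z -> exists X, P X /\ forall B, P B -> ml_test B Z ->
    ~ forall n, in_open (chi X) (fun i c => B (pr (pr n i) c)).

Definition change (g : nat -> Prop) (n s : nat) : Prop :=
  exists u v, g (pr (pr n s) u) /\ g (pr (pr n (s + 1)) v) /\ u <> v.

Definition hre (h : nat -> nat) (g : nat -> Prop) : Prop :=
  isfun g /\ forall n, exists c, (forall s, bit s c <-> change g n s) /\ card c <= h n.

Definition lim (g : nat -> Prop) (n e : nat) : Prop :=
  exists s0, forall s, s0 <= s -> g (pr (pr n s) e).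

Definition demuth_test (h : nat -> nat) (g Z : nat -> Prop) : Prop :=
  hre h g /\ turing_le g Z /\ forall n, exists e, lim g n e /\
    (forall i, exists c, phi Z e i c) /\ mu_le (phi Z e) n.

Definition passes (X g Z : nat -> Prop) : Prop :=
  exists n e, lim g n e /\ ~ in_open (chi X) (phi Z e).

Definition demuth_randoms (h : nat -> nat) (P : (nat -> Prop) -> Prop) : Prop :=
  forall Z, P Z -> exists X, P X /\ forall g, P g -> demuth_test h g Z -> passes X g Z.

Lemma sat_weak_Koenig P v V : sat (omega P) v V weak_Koenig <-> weak_koenig P.
Proof.
  apply (Sem_iff P (Env 0 v 0 V) _ (weak_koenig P)); [|tauto].
  unfold isTree, isInfinite, isPath, weak_koenig; sem.
Qed.

Lemma sat_MLR P v V : sat (omega P) v V MLR <-> ml_randoms P.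
Proof.
  apply (Sem_iff P (Env 0 v 0 V) _ (ml_randoms P)); [|tauto].
  unfold MLrandom, MLtest, ml_randoms, ml_test; sem.
Qed.

Lemma Sem_isChange P E X t1 t2 g n s :
  DenS E X g -> Den P E t1 n -> Den P E t2 s -> Sem P E (isChange X t1 t2) (change g n s).
Proof. intros; unfold isChange; sem. Qed.
#[local] Hint Extern 0 (Sem _ _ (isChange _ _ _) _) => eapply Sem_isChange : sem.

Lemma Sem_isLim P E X t1 t2 g n e :
  DenS E X g -> Den P E t1 n -> Den P E t2 e -> Sem P E (isLim X t1 t2) (lim g n e).
Proof.
  intros; eapply Sem_iff; [unfold isLim; sem|]; unfold lim.
  split; intros [s0 H2]; exists s0; intros s Hs; apply H2; lia.
Qed.
#[local] Hint Extern 0 (Sem _ _ (isLim _ _ _) _) => eapply Sem_isLim : sem.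

(** Apart from one existential number quantifier the formula is bounded, so its meaning carries over
    from the full model to every omega-model. *)
Lemma Sem_happ2 P h theta :
  sigma01 theta ->
  (forall n m v V, sat (omega (fun _ => True)) (scons n (scons m v)) V theta <-> h n = m) ->
  forall E s t a b, Den P E s a -> Den P E t b -> Sem P E (happ2 theta s t) (h a = b).
Proof.
  intros [d [Hd ->]] H E s t a b Hs Ht; unfold Sem, happ2.
  rewrite sat_subst.
  replace (fun i => eval (omega P) (valN E) (scons (s (depN E)) (scons (t (depN E)) Var) i))
    with (scons a (scons b (valN E))).
  - rewrite <- (H a b (valN E) (valS E)); cbn [sat].
    split; intros [k Hk]; exists k; revert Hk; now apply delta00_sat_sets.
  - apply functional_extensionality; intros [|[|i]]; simpl; auto; symmetry;
      now apply Den_eval.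
Qed.

Lemma Sem_isHre P E h theta X g :
  (forall E s t a b, Den P E s a -> Den P E t b -> Sem P E (happ2 theta s t) (h a = b)) ->
  DenS E X g -> Sem P E (isHre theta X) (hre h g).
Proof.
  intros; eapply Sem_iff; [unfold isHre; sem|]; unfold hre; split.
  - intros [H1 H2]; split; [exact H1|]; intros n.
    destruct (H2 n) as (c & k & m & H3 & -> & <- & H4); exists c; split; [exact H3 | lia].
  - intros [H1 H2]; split; [exact H1|]; intros n.
    destruct (H2 n) as (c & H3 & H4); exists c, (card c), (h n); repeat split; auto;
      [apply H3 | apply H3 | lia].
Qed.

Lemma sat_WDR P h theta v V :
  (forall E s t a b, Den P E s a -> Den P E t b -> Sem P E (happ2 theta s t) (h a = b)) ->
  sat (omega P) v V (WDR theta) <-> demuth_randoms h P.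
Proof.
  intros H; apply (Sem_iff P (Env 0 v 0 V) _ (demuth_randoms h P)); [|tauto].
  unfold weakly_Demuth_random, DemuthTest, weakly_passes, demuth_randoms, demuth_test, passes.
  eapply Sem_allS; intros; eapply Sem_exS; intros; eapply Sem_allS; intros.
  eapply Sem_imp; [eapply Sem_and; [eapply Sem_isHre; [exact H | solve_denS]|]|]; sem.
Qed.

(** * Kleene's functionals *)

Definition closed_comp (Z : nat -> Prop) (C : nat -> nat -> nat -> Prop) : Prop :=
  forall e x y, C e x y -> step Z C e x y.

(** [C] occurs only positively; in the scheme for least zeros, a nonzero value is asserted by
    exhibiting it. Thus closed sets of values have closed unions. *)
Lemma step_mono Z (C C' : nat -> nat -> nat -> Prop) e x y :
  (forall e x y, C e x y -> C' e x y) -> step Z C e x y -> step Z C' e x y.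
Proof.
  intros H (t & a & b & -> & H4); exists t, a, b; split; [reflexivity|]; revert H4.
  intros [H4|[H4|[H4|[H4|[H4|[H4|[H4|[H4|H4]]]]]]]]; [tauto|tauto|tauto|tauto|tauto| | | |].
  - do 5 right; left; destruct H4 as [Ht (u & w & H4 & H5 & H6)]; eauto 10.
  - do 6 right; left; destruct H4 as [Ht (u & H4 & H5)]; eauto 10.
  - do 7 right; left; destruct H4 as [Ht (z & n & -> & [H4|(m & u & -> & H5 & H6)])];
      (split; [exact Ht|]); exists z; [exists n | exists (m + 1)]; intuition eauto 10.
  - do 8 right; destruct H4 as [Ht [H5 H6]]; split; [exact Ht|]; split; [auto|].
    intros k Hk; destruct (H6 k Hk) as (u & H7 & H8); eauto.
Qed.

Lemma step_oracle Z Z' C e x y :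
  (Z x <-> Z' x) -> step Z C e x y -> step Z' C e x y.
Proof.
  intros H (t & a & b & -> & H4); exists t, a, b; split; [reflexivity|]; tauto.
Qed.

(** Induction on the index, since the component indices [a] and [b] are smaller than [e]. Only
    primitive recursion refers to [e] itself, and then with a smaller recursion argument, which
    calls for a second induction. *)
Lemma step_functional Z C C' : closed_comp Z C -> closed_comp Z C' ->
  forall e x y y', C e x y -> C' e x y' -> y = y'.
Proof.
  intros HC HC' e; induction e as [e IH] using lt_wf_ind.
  assert (Hrec : forall t a b, e = pr t (pr a b) -> 5 <= t ->
    (forall x y y', C a x y -> C' a x y' -> y = y') /\
    (forall x y y', C b x y -> C' b x y' -> y = y')).
  { intros t a b -> Ht; pose proof (pr_lt_r t (pr a b)).
    pose proof (pr_le_l a b); pose proof (pr_le_r a b); split; apply IH; lia. }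
  (* Uniqueness at [x], given uniqueness for the same index at the preceding recursion argument;
     [Hprim] discharges this premise afterwards. *)
  assert (Hstep : forall x y y', (forall z n m u u', x = pr z n -> n = m + 1 ->
    C e (pr z m) u -> C' e (pr z m) u' -> u = u') -> C e x y -> C' e x y' -> y = y').
  { intros x y y' Hprim H1 H2.
    destruct (HC _ _ _ H1) as (t & a & b & E & D1), (HC' _ _ _ H2) as (t' & a' & b' & E' & D2).
    specialize (Hrec t a b E).
    assert (Ha := fun H => proj1 (Hrec H)); assert (Hb := fun H => proj2 (Hrec H)); clear Hrec.
    rewrite E in E'; apply pr_inj in E' as [<- E']; apply pr_inj in E' as [<- <-].
    destruct D1 as [D1|[D1|[D1|[D1|[D1|[D1|[D1|[D1|D1]]]]]]]], D1 as [-> D1];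
      destruct D2 as [D2|[D2|[D2|[D2|[D2|[D2|[D2|[D2|D2]]]]]]]], D2 as [Q D2];
      try discriminate Q; clear Q.
    - congruence.
    - congruence.
    - destruct D1 as [r D1], D2 as [r' D2]; rewrite D1 in D2; now apply pr_inj in D2.
    - destruct D1 as [r D1], D2 as [r' D2]; rewrite D1 in D2; now apply pr_inj in D2.
    - destruct D1, D2; intuition congruence.
    - destruct D1 as (u & w & D3 & D4 & ->), D2 as (u' & w' & D5 & D6 & ->).
      f_equal; [apply (Ha ltac:(lia) _ _ _ D3 D5) | apply (Hb ltac:(lia) _ _ _ D4 D6)].
    - destruct D1 as (u & D3 & D4), D2 as (u' & D5 & D6).
      pose proof (Hb ltac:(lia) _ _ _ D3 D5); subst u'.
      apply (Ha ltac:(lia) _ _ _ D4 D6).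
    - destruct D1 as (z & n & -> & D3), D2 as (z' & n' & Ex & D4).
      apply pr_inj in Ex as [<- <-].
      destruct D3 as [[-> D3]|(m & u & -> & D3 & D5)], D4 as [[En D4]|(m' & u' & En & D4 & D6)];
        try lia.
      + apply (Ha ltac:(lia) _ _ _ D3 D4).
      + assert (m = m') by lia; subst m'.
        pose proof (Hprim z (m + 1) m u u' eq_refl eq_refl D3 D4); subst u'.
        apply (Hb ltac:(lia) _ _ _ D5 D6).
    - destruct D1 as [D3 D4], D2 as [D5 D6].
      destruct (lt_eq_lt_dec y y') as [[L|L]|L]; auto; exfalso.
      + destruct (D6 y L) as (u & D7 & D8).
        pose proof (Ha ltac:(lia) _ _ _ D3 D7); lia.
      + destruct (D4 y' L) as (u & D7 & D8).
        pose proof (Ha ltac:(lia) _ _ _ D7 D5); lia. }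
  assert (Hprim : forall n z y y', C e (pr z n) y -> C' e (pr z n) y' -> y = y').
  { induction n as [n IHn] using lt_wf_ind; intros z y y'; apply Hstep.
    intros z' n' m u u' Ex ->; apply pr_inj in Ex as [<- ->].
    apply IHn; lia. }
  intros x y y'; destruct (pr_surj x) as [z [n ->]]; apply Hprim.
Qed.

Lemma phi_functional Z e x y y' : phi Z e x y -> phi Z e x y' -> y = y'.
Proof.
  intros [D [H1 H2]] [D' [H3 H4]]; eapply (step_functional Z (inD D) (inD D')); eauto.
Qed.

(** Elements of a coded finite set are smaller than its code, and pairs bound their components; so
    [D] itself bounds all oracle queries. *)
Lemma phi_use Z e x y : phi Z e x y ->
  exists u, forall Z' : nat -> Prop, (forall n, n < u -> Z n <-> Z' n) -> phi Z' e x y.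
Proof.
  intros [D [H1 H2]]; exists D; intros Z' H; exists D; split; [exact H1|].
  intros e' x' y' H3; apply (step_oracle Z); [|auto].
  apply H; unfold inD in H3; apply bit_lt in H3.
  pose proof (pr_le_r e' (pr x' y')); pose proof (pr_le_l x' y'); lia.
Qed.

Lemma inD_comprehension (C : nat -> nat -> nat -> Prop) N :
  (forall e x y, C e x y -> pr e (pr x y) < N) ->
  exists D, forall e x y, inD D e x y <-> C e x y.
Proof.
  intros H; destruct (bit_comprehension
    (fun i => exists e x y, i = pr e (pr x y) /\ C e x y) N) as [D HD].
  - intros i (e & x & y & -> & H1); auto.
  - exists D; intros e x y; unfold inD; rewrite HD; split; [|eauto 10].
    intros (e' & x' & y' & E & H1); apply pr_inj in E as [-> E].
    apply pr_inj in E as [-> ->]; exact H1.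
Qed.

Lemma phi_intro Z e x y D : 
  (forall e' x' y', inD D e' x' y' -> step Z (inD D) e' x' y') ->
  step Z (inD D) e x y -> phi Z e x y.
Proof.
  intros HD H.
  destruct (inD_comprehension (fun e' x' y' => inD D e' x' y' \/ (e' = e /\ x' = x /\ y' = y))
    (S (Nat.max D (pr e (pr x y))))) as [D' HD'].
  { intros e' x' y' [H1|(-> & -> & ->)]; [apply bit_lt in H1|]; lia. }
  exists D'; split; [apply HD'; auto|].
  intros e' x' y' H1; apply (step_mono _ (inD D)); [intros; apply HD'; auto|].
  apply HD' in H1 as [H1|(-> & -> & ->)]; auto.
Qed.

Lemma phi_union Z e x y e' x' y' : phi Z e x y -> phi Z e' x' y' ->
  exists D, (forall e x y, inD D e x y -> step Z (inD D) e x y) /\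
    inD D e x y /\ inD D e' x' y'.
Proof.
  intros [D1 [H1 H2]] [D2 [H3 H4]].
  destruct (inD_comprehension (fun e x y => inD D1 e x y \/ inD D2 e x y)
    (Nat.max D1 D2)) as [D HD].
  { intros a b c [H|H]; apply bit_lt in H; lia. }
  exists D; split; [|split; apply HD; auto].
  intros a b c H; apply HD in H as [H|H]; [apply H2 in H | apply H4 in H];
    (eapply step_mono; [|exact H]); intros; apply HD; auto.
Qed.

Definition i_comp (a b : nat) : nat := pr 6 (pr a b).
Definition i_pair (a b : nat) : nat := pr 5 (pr a b).
Definition i_oracle : nat := pr 4 (pr 0 0).
(** The identity is not among the schemes; since every number is a pair, it is the pair of the two
    projections. *)
Definition i_id : nat := i_pair (pr 2 (pr 0 0)) (pr 3 (pr 0 0)).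
Fixpoint i_const (c : nat) : nat :=
  match c with 0 => pr 0 (pr 0 0) | S d => i_comp (pr 1 (pr 0 0)) (i_const d) end.

Lemma phi_base Z t x y :
  (t = 0 /\ y = 0) \/ (t = 1 /\ y = x + 1) \/ (t = 2 /\ exists r, x = pr y r) \/
  (t = 3 /\ exists l, x = pr l y) \/ (t = 4 /\ ((Z x /\ y = 1) \/ (~ Z x /\ y = 0))) ->
  phi Z (pr t (pr 0 0)) x y.
Proof.
  intros H; apply (phi_intro Z _ _ _ 0).
  - intros e' x' y' H1; apply bit_lt in H1; lia.
  - exists t, 0, 0; split; [reflexivity | tauto].
Qed.

Lemma phi_comp Z a b x u y : phi Z b x u -> phi Z a u y -> phi Z (i_comp a b) x y.
Proof.
  intros H1 H2; destruct (phi_union _ _ _ _ _ _ _ H1 H2) as (D & HD & H3 & H4).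
  apply (phi_intro Z _ _ _ D HD); exists 6, a, b; split; [reflexivity|].
  do 6 right; left; eauto.
Qed.

Lemma phi_pair Z a b x u w : phi Z a x u -> phi Z b x w -> phi Z (i_pair a b) x (pr u w).
Proof.
  intros H1 H2; destruct (phi_union _ _ _ _ _ _ _ H1 H2) as (D & HD & H3 & H4).
  apply (phi_intro Z _ _ _ D HD); exists 5, a, b; split; [reflexivity|].
  do 5 right; left; eauto 10.
Qed.

Lemma phi_id Z x : phi Z i_id x x.
Proof.
  destruct (pr_surj x) as [u [w ->]]; apply phi_pair; apply phi_base; eauto 10.
Qed.

Lemma phi_const Z c x : phi Z (i_const c) x c.
Proof.
  induction c as [|c IH]; [apply phi_base; auto|].
  eapply phi_comp; [exact IH|]; apply phi_base; right; left; lia.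
Qed.

Lemma turing_le_section Z c : turing_le (fun x => Z (pr c x)) Z.
Proof.
  exists (i_comp i_oracle (i_pair (i_const c) i_id)); intros n.
  assert (H : phi Z (i_pair (i_const c) i_id) n (pr c n))
    by (apply phi_pair; [apply phi_const | apply phi_id]).
  split; intros Hn; apply (phi_comp _ _ _ _ _ _ H), phi_base; do 4 right; auto.
Qed.

(** * Leftmost elements and compactness of Cantor space *)

Definition agree {B : Type} (m : nat) (x y : nat -> B) : Prop := forall i, i < m -> x i = y i.

Lemma val_agree m x y : agree m x y -> val m x = val m y.
Proof.
  induction m; intros H; cbn [val]; [reflexivity|].
  rewrite IHm, H by (auto || (intros i Hi; apply H; lia)); reflexivity.
Qed.

Lemma agree_val m x y : val m x = val m y -> agree m x y.
Proof.
  induction m; intros H i Hi; [lia|]; cbn [val] in H.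
  destruct (Nat.eq_dec i m) as [->|].
  - destruct (x m), (y m); simpl in H; auto; lia.
  - apply IHm; [destruct (x m), (y m); simpl in H; lia | lia].
Qed.

Lemma str_agree m x y : agree m x y -> str m x = str m y.
Proof. intros H; unfold str; now rewrite (val_agree m x y). Qed.

(** The greedy choice of bits. For nonempty [K] it gives the lexicographic infimum, which lies in
    the closure of [K] but need not belong to [K]. *)
Definition is_leftmost (K : (nat -> bool) -> Prop) (x : nat -> bool) : Prop :=
  forall n, x n = false <-> exists y, K y /\ agree n y x /\ y n = false.

Lemma is_leftmost_exists K : exists x, is_leftmost K x.
Proof.
  apply (strong_recursion false
    (fun x n b => b = false <-> exists y, K y /\ agree n y x /\ y n = false)).
  - intros x x' n b H ->; split; intros [y [H1 [H2 H3]]]; exists y; repeat split; auto;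
      intros i Hi; rewrite H2 by auto; auto; symmetry; auto.
  - intros x n; destruct (classic (exists y, K y /\ agree n y x /\ y n = false)).
    + exists false; tauto.
    + exists true; split; [discriminate | tauto].
Qed.

Definition leftmost (K : (nat -> bool) -> Prop) : nat -> bool :=
  proj1_sig (constructive_indefinite_description _ (is_leftmost_exists K)).

Lemma leftmost_spec K : is_leftmost K (leftmost K).
Proof. exact (proj2_sig (constructive_indefinite_description _ (is_leftmost_exists K))). Qed.

Lemma leftmost_attained K n : (exists y, K y) -> exists y, K y /\ agree n y (leftmost K).
Proof.
  intros HK; induction n as [|n [y [H1 H2]]].
  - destruct HK as [y Hy]; exists y; split; [auto | intros i Hi; lia].
  - destruct (leftmost K n) eqn:E.
    + exists y; split; auto; intros i Hi.
      destruct (Nat.eq_dec i n) as [->|]; [|apply H2; lia].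
      destruct (y n) eqn:F; auto.
      enough (leftmost K n = false) by congruence; apply leftmost_spec; eauto.
    + destruct (proj1 (leftmost_spec K n) E) as [z [H3 [H4 H5]]].
      exists z; split; auto; intros i Hi.
      destruct (Nat.eq_dec i n) as [->|]; [|apply H4; lia].
      congruence.
Qed.

Lemma leftmost_min K y m : K y -> val m (leftmost K) <= val m y.
Proof.
  intros Hy; induction m as [|m IH]; cbn [val]; [lia|].
  destruct (Nat.eq_dec (val m (leftmost K)) (val m y)) as [E|].
  - destruct (y m) eqn:F, (leftmost K m) eqn:G; simpl; try lia.
    enough (leftmost K m = false) by congruence.
    apply leftmost_spec; exists y; repeat split; auto; now apply agree_val.
  - destruct (y m), (leftmost K m); simpl; lia.
Qed.

(** Each initial segment of the leftmost point of [K'] is realized in [K'], hence in [K]. So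
    shrinking a class can only move its leftmost point to the right, which bounds the number of
    changes later. *)
Lemma leftmost_antitone (K K' : (nat -> bool) -> Prop) m :
  (forall y, K' y -> K y) -> (exists y, K' y) ->
  val m (leftmost K) <= val m (leftmost K').
Proof.
  intros H H'; destruct (leftmost_attained K' m H') as [y [H1 H2]].
  rewrite <- (val_agree m y (leftmost K')) by auto; apply leftmost_min; auto.
Qed.

Lemma nondecreasing_le (f : nat -> nat) :
  (forall s, f s <= f (S s)) -> forall s t, s <= t -> f s <= f t.
Proof. intros H s t; induction 1; auto; specialize (H m); lia. Qed.

Lemma nondecreasing_stable (f : nat -> nat) N :
  (forall s, f s <= f (S s)) -> (forall s, f s < N) ->
  exists s0, forall s, s0 <= s -> f s = f s0.
Proof.
  intros Hf HN; enough (H : forall k s, N - f s <= k ->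
    exists s0, forall s, s0 <= s -> f s = f s0) by (apply (H N 0); lia).
  induction k as [|k IH]; intros s Hs; [specialize (HN s); lia|].
  destruct (classic (exists t, s <= t /\ f t <> f s)) as [[t [H1 H2]]|H].
  - apply (IH t); pose proof (nondecreasing_le f Hf s t H1); lia.
  - exists s; intros t Ht; destruct (Nat.eq_dec (f t) (f s)); auto.
    exfalso; eauto.
Qed.

Lemma leftmost_limit (K : nat -> (nat -> bool) -> Prop) :
  (forall t y, K (S t) y -> K t y) -> (forall t, exists y, K t y) ->
  exists x, forall m, exists t0, forall t, t0 <= t -> agree m (leftmost (K t)) x.
Proof.
  intros HK Hne.
  assert (Hst : forall m, exists t0, forall t, t0 <= t ->
    agree m (leftmost (K t)) (leftmost (K t0))).
  { intros m; destruct (nondecreasing_stable (fun t => val m (leftmost (K t))) (2 ^ m))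
      as [t0 H]; [intros; apply leftmost_antitone; auto | intros; apply val_lt |].
    exists t0; intros t Ht; apply agree_val; auto. }
  destruct (choice _ Hst) as [T HT].
  (* Bit [i] is read off at a stage where the first [S i] bits have settled; the common later stage
     [t'] compares this with stage [t]. *)
  exists (fun i => leftmost (K (T (S i))) i); intros m; exists (T m); intros t Ht i Hi.
  set (t' := Nat.max t (T (S i))).
  rewrite <- (HT (S i) t') by lia.
  rewrite (HT m t), (HT m t') by lia; reflexivity.
Qed.

Lemma decreasing_le (K : nat -> (nat -> bool) -> Prop) :
  (forall t y, K (S t) y -> K t y) -> forall s t y, s <= t -> K t y -> K s y.
Proof. intros H s t y; induction 1; auto. Qed.

(** The classes are not assumed to be closed, so the limit point is only claimed to be in the
    closure of each of them. *)
Lemma compactness (K : nat -> (nat -> bool) -> Prop) :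
  (forall t y, K (S t) y -> K t y) -> (forall t, exists y, K t y) ->
  exists x, forall t m, exists y, K t y /\ agree m y x.
Proof.
  intros HK Hne; destruct (leftmost_limit K HK Hne) as [x Hx]; exists x; intros t m.
  destruct (Hx m) as [t0 H0].
  destruct (leftmost_attained (K (Nat.max t t0)) m (Hne _)) as [y [H1 H2]].
  exists y; split; [revert H1; apply decreasing_le; auto; lia|].
  intros i Hi; rewrite H2, H0 by lia; auto.
Qed.

Definition total2 (R : (nat -> bool) -> (nat -> bool) -> Prop) : Prop :=
  forall z, exists x, R z x.

Definition closed2 (R : (nat -> bool) -> (nat -> bool) -> Prop) : Prop := forall z x,
  (forall u, exists z' x', agree u z' z /\ agree u x' x /\ R z' x') -> R z x.

Lemma agree_le {B : Type} m n (x y : nat -> B) : m <= n -> agree n x y -> agree m x y.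
Proof. intros H H1 i Hi; apply H1; lia. Qed.

Lemma str_lt k l x : k <= l -> str k x < 2 ^ (S l).
Proof.
  intros H; pose proof (str_succ k x); pose proof (val_lt k x).
  assert (2 ^ S k <= 2 ^ S l) by (apply Nat.pow_le_mono_r; lia).
  cbn [Nat.pow] in *; lia.
Qed.

(** * Paths through trees *)

Definition branch (T : nat -> bool) (l : nat) (x : nat -> bool) : Prop :=
  forall k, k <= l -> T (str k x) = true.

(** Making each level conditional on the existence of a branch of that length gives a relation that
    is total for every [T], tree or not, and still closed. On an infinite tree the condition holds
    at all levels. *)
Definition path_rel (T x : nat -> bool) : Prop :=
  forall l, (exists y, branch T l y) -> branch T l x.

Lemma path_rel_total : total2 path_rel.
Proof.
  intros T; destruct (compactness (fun t x => forall l, l <= t ->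
    (exists y, branch T l y) -> branch T l x)) as [x Hx].
  - intros t y H l Hl; apply H; lia.
  - induction t as [|t [y Hy]].
    + destruct (classic (exists y, branch T 0 y)) as [[y Hy]|H].
      * exists y; intros l Hl _; now replace l with 0 by lia.
      * exists (fun _ => false); intros l Hl; replace l with 0 by lia; tauto.
    + destruct (classic (exists y, branch T (S t) y)) as [[z Hz]|H].
      * exists z; intros l Hl _ k Hk; apply Hz; lia.
      * exists y; intros l Hl Hb; destruct (Nat.eq_dec l (S t)) as [->|]; [tauto|].
        apply Hy; auto; lia.
  - exists x; intros l Hl; destruct (Hx l l) as [y [H1 H2]]; intros k Hk.
    rewrite <- (str_agree k y) by (eapply agree_le; eauto); apply (H1 l); auto.
Qed.

Lemma path_rel_closed : closed2 path_rel.
Proof.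
  intros T x H l [y Hy] k Hk.
  (* Strings of length at most [l] have codes below [2 ^ S l], so [T'] has the same branches of
     length [l] as [T]. *)
  destruct (H (2 ^ S l)) as (T' & x' & HT & Hx & HR).
  rewrite <- (str_agree k x' x), <- HT.
  - apply (HR l); auto; exists y; intros j Hj; rewrite HT; [auto | now apply str_lt].
  - now apply str_lt.
  - eapply agree_le; [|exact Hx].
    pose proof (Nat.pow_gt_lin_r 2 (S l)); lia.
Qed.

Lemma path_rel_weak_koenig (T x : nat -> bool) :
  (forall s t, T s = true /\ prefix t s -> T t = true) ->
  (forall n, exists s, n < s /\ T s = true) ->
  path_rel T x -> forall s, initial s x -> T s = true.
Proof.
  intros HT Hinf Hx s [l ->]; apply (Hx l); auto; clear Hx.
  (* A member of the tree with so large a code is longer than [l], and its initial segments form the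
     required branch. *)
  destruct (Hinf (2 ^ S l)) as [s [Hs HTs]].
  pose proof (isstr_exists s) as [H1 H2].
  set (y := bits (len s) (s + 1 - 2 ^ len s)).
  assert (E : s = str (len s) y).
  { pose proof (str_succ (len s) y) as E; unfold y in E at 2; rewrite val_bits in E by auto.
    lia. }
  assert (l <= len s).
  { apply Nat.lt_le_incl, Nat.nle_gt; intros H; pose proof (str_lt _ _ y H); lia. }
  exists y; intros k Hk; apply (HT s); split; auto; rewrite E; apply prefix_str; lia.
Qed.

(** * Random sets *)

Definition cnt (N : nat) (P : nat -> Prop) : nat := sum N (fun x => Nat.b2n (chi P x)).

Lemma chi_le_sum n (Q : nat -> nat -> Prop) x (p : nat -> Prop) :
  (p x -> exists i, i < n /\ Q i x) ->
  Nat.b2n (chi p x) <= sum n (fun i => Nat.b2n (chi (Q i) x)).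
Proof.
  intros H; destruct (chi p x) eqn:E; simpl; [|lia].
  apply chi_true in E; apply H in E as [i [Hi HQ]]; apply chi_true in HQ.
  transitivity (sum n (fun j => if j =? i then 1 else 0)); [rewrite sum_single; auto|].
  apply sum_le; intros j _; destruct (Nat.eqb_spec j i) as [->|]; [rewrite HQ; auto | lia].
Qed.

Lemma sum_add n f g : sum n (fun i => f i + g i) = sum n f + sum n g.
Proof. induction n; simpl; lia. Qed.

Lemma cnt_union N (P : nat -> Prop) n (Q : nat -> nat -> Prop) :
  (forall x, P x -> exists i, i < n /\ Q i x) -> cnt N P <= sum n (fun i => cnt N (Q i)).
Proof.
  intros H; induction N; unfold cnt in *; simpl; [lia|].
  rewrite sum_add; pose proof (chi_le_sum n Q N P (H N)); lia.
Qed.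

Lemma cnt_block N d q : 0 < d -> cnt N (fun x => x / d = q) <= d.
Proof.
  (* The block is an interval starting at [q * d], so at most [N - q * d] of its elements are below
     [N]. *)
  intros Hd; enough (cnt N (fun x => x / d = q) <= Nat.min d (N - q * d)) by lia.
  induction N as [|N IH]; unfold cnt in *; cbn [sum]; [lia|].
  destruct (chi (fun x => x / d = q) N) eqn:E; cbn [Nat.b2n]; [|lia].
  apply chi_true in E; pose proof (Nat.div_mod N d ltac:(lia)) as H.
  pose proof (Nat.mod_upper_bound N d ltac:(lia)); rewrite E, Nat.mul_comm in H; lia.
Qed.

Lemma cnt_lt N (P : nat -> Prop) : cnt N P < N -> exists x, x < N /\ ~ P x.
Proof.
  intros H; apply NNPP; intros HN; enough (cnt N P = N) by lia.
  assert (HP : forall x, x < N -> P x) by (intros x Hx; apply NNPP; eauto).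
  clear H HN; induction N; unfold cnt in *; simpl; [auto|].
  assert (E : chi P N = true) by (apply chi_true; auto); rewrite E, IHN; simpl; auto; lia.
Qed.

(** Here [x] is the value of a string of length [L]. Dropping its last [L - len s] bits leaves the
    value of an initial segment, and [s + 1 - 2 ^ len s] is the value of [s]; so some minimal [s] is
    an initial segment of the string. *)
Definition covered (c L x : nat) : Prop :=
  exists s, minimal s c /\ len s <= L /\ x / 2 ^ (L - len s) = s + 1 - 2 ^ len s.

(** Measure becomes counting: a minimal [s] has at most [2 ^ (L - len s)] extensions of length [L],
    which is its weight over [2 ^ l] scaled by [2 ^ (L - l)]. *)
Lemma mu_fin_cover c n : mu_fin_le c n -> exists l, forall L, l <= L ->
  (forall s, minimal s c -> len s <= L) /\ cnt (2 ^ L) (covered c L) * 2 ^ n <= 2 ^ L.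
Proof.
  intros (l & f & Hf & H); exists l; intros L HL.
  assert (Hlen : forall s, minimal s c -> s < c /\ len s <= l /\ f s = 2 ^ (l - len s)).
  { intros s Hs; pose proof (bit_lt _ _ (proj1 Hs)) as Hc.
    destruct (Hf s Hc) as [?|?]; tauto. }
  split; [intros s Hs; apply Hlen in Hs; lia|].
  assert (E : cnt (2 ^ L) (covered c L) <= sum c f * 2 ^ (L - l)).
  { rewrite sum_mul_r; etransitivity.
    - apply (cnt_union _ _ c (fun s x => minimal s c /\ x / 2 ^ (L - len s) = s + 1 - 2 ^ len s)).
      intros x (s & H1 & H2 & H3); exists s; pose proof (Hlen s H1); tauto.
    - apply sum_le; intros s Hs; destruct (classic (minimal s c)) as [Hm|Hm].
      + destruct (Hlen s Hm) as (_ & H1 & ->); rewrite <- Nat.pow_add_r.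
        replace (l - len s + (L - l)) with (L - len s) by lia.
        etransitivity; [|apply (cnt_block (2 ^ L) _ (s + 1 - 2 ^ len s)), pow2_pos].
        apply sum_le; intros x _; destruct (chi _ x) eqn:F; simpl; [|lia].
        apply chi_true in F as [_ F].
        enough (G : chi (fun x => x / 2 ^ (L - len s) = s + 1 - 2 ^ len s) x = true)
          by (rewrite G; auto).
        now apply chi_true.
      + enough (G : forall N, cnt N (fun x => minimal s c /\
          x / 2 ^ (L - len s) = s + 1 - 2 ^ len s) = 0) by (rewrite G; lia).
        induction N; unfold cnt in *; simpl; auto; rewrite IHN.
        destruct (chi _ N) eqn:F; auto; apply chi_true in F; tauto. }
  replace (2 ^ L) with (2 ^ l * 2 ^ (L - l)) at 2
    by (rewrite <- Nat.pow_add_r; f_equal; lia).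
  nia.
Qed.

(** The shortest initial segment of [x] in [c] is minimal, because prefixes of initial segments of
    [x] are again initial segments of [x]. *)
Lemma open_covered c L s x :
  (forall s, minimal s c -> len s <= L) -> bit s c -> initial s x -> covered c L (val L x).
Proof.
  intros HL Hs [k ->].
  assert (Hmin : exists j, bit (str j x) c /\ forall i, i < j -> ~ bit (str i x) c).
  { clear HL; induction k as [k IH] using lt_wf_ind.
    destruct (classic (exists j, j < k /\ bit (str j x) c)) as [[j [Hj H]]|H]; [eauto|].
    exists k; split; eauto. }
  destruct Hmin as [j [Hj Hmin]].
  assert (Hm : minimal (str j x) c).
  { split; auto; intros (t & H1 & H2 & H3); apply prefix_of_str in H2 as [i [Hi ->]].
    apply (Hmin i); auto; destruct (Nat.eq_dec i j) as [->|]; [tauto | lia]. }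
  exists (str j x); split; auto; specialize (HL _ Hm); split; auto.
  rewrite len_str in *; rewrite str_succ.
  destruct (val_split x j L HL) as [r [H1 ->]].
  rewrite Nat.div_add_l, Nat.div_small by lia; lia.
Qed.

(* Asking for the least c accepted by Phi_e makes [cs] unique even when Phi_e does not
   compute the graph of a function, so that for each e a single open set is avoided. *)
Definition valid (Z : nat -> Prop) (e m : nat) (cs : nat -> nat) : Prop :=
  forall i, i <= m -> phi Z e (pr (pr (e + 2) i) (cs i)) 1 /\
    forall c, c < cs i -> phi Z e (pr (pr (e + 2) i) c) 0.

Definition level (Z : nat -> Prop) (e m c : nat) : Prop :=
  exists cs, valid Z e m cs /\ mu_fin_le c (e + 2) /\
    forall s, bit s c <-> exists i, i <= m /\ bit s (cs i).

(** For each index [e] only component [e + 2] of the possible test is avoided. One avoided component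
    suffices to pass a test, and the measures $2^{-(e+2)}$ sum to $1/2$, which leaves room for all
    [e] at once. *)
Definition random_rel (z x : nat -> bool) : Prop := forall e m c,
  level (fun n => z n = true) e m c -> forall s, bit s c -> ~ initial s x.

Lemma valid_unique Z e m m' cs cs' i :
  valid Z e m cs -> valid Z e m' cs' -> i <= m -> i <= m' -> cs i = cs' i.
Proof.
  intros H H' Hi Hi'; destruct (H i Hi) as [H1 H2], (H' i Hi') as [H3 H4].
  destruct (lt_eq_lt_dec (cs i) (cs' i)) as [[L|L]|L]; auto; exfalso.
  - pose proof (phi_functional _ _ _ _ _ H1 (H4 _ L)); lia.
  - pose proof (phi_functional _ _ _ _ _ H3 (H2 _ L)); lia.
Qed.

Lemma level_use Z e m c : level Z e m c ->
  exists u, forall Z' : nat -> Prop, (forall n, n < u -> Z n <-> Z' n) -> level Z' e m c.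
Proof.
  intros (cs & Hv & Hmu & Hc).
  destruct (bounded_choice_max (fun i u => forall Z' : nat -> Prop,
    (forall n, n < u -> Z n <-> Z' n) -> phi Z' e (pr (pr (e + 2) i) (cs i)) 1 /\
    forall c, c < cs i -> phi Z' e (pr (pr (e + 2) i) c) 0) (S m)) as [u Hu].
  - intros i Hi; destruct (Hv i) as [H1 H2]; [lia|].
    destruct (phi_use _ _ _ _ H1) as [u1 Hu1].
    destruct (bounded_choice_max (fun c u => forall Z' : nat -> Prop,
      (forall n, n < u -> Z n <-> Z' n) -> phi Z' e (pr (pr (e + 2) i) c) 0) (cs i)) as [u2 Hu2].
    + intros d Hd; destruct (phi_use _ _ _ _ (H2 d Hd)) as [u Hu]; exists u.
      intros u' Hu' Z' HZ; apply Hu; intros n Hn; apply HZ; lia.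
    + exists (Nat.max u1 u2); intros u' Hu' Z' HZ; split.
      * apply Hu1; intros n Hn; apply HZ; lia.
      * intros d Hd; apply (Hu2 d Hd u'); auto; lia.
  - exists u; intros Z' HZ; exists cs; split; [|split; auto].
    intros i Hi; apply (Hu i) with (u' := u); auto; lia.
Qed.

(** A violation shows in finitely many bits, namely the use [u] of the computations behind the level
    and the length [k] of the offending string; so it persists in a neighbourhood. *)
Lemma random_rel_closed : closed2 random_rel.
Proof.
  intros z x H e m c Hl s Hs [k ->].
  destruct (level_use _ _ _ _ Hl) as [u Hu].
  destruct (H (Nat.max u k)) as (z' & x' & Hz & Hx & HR).
  apply (HR e m c) with (s := str k x); auto.
  - apply Hu; intros n Hn; rewrite Hz by lia; tauto.
  - exists k; symmetry; apply str_agree; eapply agree_le; [|exact Hx]; lia.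
Qed.

Lemma mu_fin_le_0 n : mu_fin_le 0 n.
Proof. exists 0, (fun _ => 0); split; [intros s Hs; lia | simpl; lia]. Qed.

(** By [valid_unique] the levels of one index increase with [m], so the last existing one below [t]
    contains the others; if there is none, the empty set will do. *)
Lemma level_dominated Z e t : exists c, mu_fin_le c (e + 2) /\
  forall m d, m < t -> level Z e m d -> forall s, bit s d -> bit s c.
Proof.
  induction t as [|t [c [Hc IH]]].
  - exists 0; split; [apply mu_fin_le_0 | intros; lia].
  - destruct (classic (exists d, level Z e t d)) as [[d Hd]|H].
    + destruct Hd as (cs & Hv & Hmu & Hd); exists d; split; auto.
      intros m d' Hm (cs' & Hv' & _ & Hd') s Hs.
      apply Hd' in Hs as [i [Hi Hs]]; apply Hd; exists i; split; [lia|].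
      rewrite (valid_unique _ _ _ _ _ _ i Hv Hv') by lia; auto.
    + exists c; split; auto; intros m d Hm Hd.
      destruct (Nat.eq_dec m t) as [->|]; [exfalso; eauto | apply (IH m); auto; lia].
Qed.

Lemma geometric_union L T (a : nat -> nat) :
  (forall e, e < T -> a e * 2 ^ (e + 2) <= 2 ^ L) -> sum T a < 2 ^ L.
Proof.
  (* This is the partial sum of the geometric series, $\sum_{e<T} 2^{-(e+2)} = 1/2 - 2^{-(T+1)}$,
     multiplied by [2 ^ (T + 1)] and [2 ^ L]. *)
  intros H; enough (E : 2 ^ (T + 1) * sum T a + 2 ^ L <= 2 ^ T * 2 ^ L).
  { pose proof (pow2_pos L); pose proof (pow2_pos T).
    rewrite Nat.pow_add_r in E; simpl (2 ^ 1) in E; nia. }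
  induction T as [|T IH]; [simpl; lia|].
  assert (IH' : 2 ^ (T + 1) * sum T a + 2 ^ L <= 2 ^ T * 2 ^ L) by (apply IH; auto).
  specialize (H T (le_n _)); cbn [sum].
  replace (S T + 1) with (T + 2) by lia.
  rewrite Nat.mul_add_distr_l, (Nat.mul_comm _ (a T)).
  replace (2 ^ (T + 2)) with (2 * 2 ^ (T + 1)) at 1
    by (replace (T + 2) with (S (T + 1)) by lia; reflexivity).
  cbn [Nat.pow]; lia.
Qed.

Lemma uniform_bound (P : nat -> nat -> Prop) n :
  (forall e, exists l, forall L, l <= L -> P e L) -> exists L, forall e, e < n -> P e L.
Proof.
  intros H; destruct (bounded_choice_max P n) as [L HL]; [auto|].
  exists L; intros e He; apply (HL e He); auto.
Qed.

(** For indices and levels below [t], the sets to be avoided have total measure less than 1, so some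
    string of length [L] is left over; compactness then removes the bound [t]. *)
Lemma random_rel_total : total2 random_rel.
Proof.
  intros z; set (Z := fun n => z n = true).
  destruct (compactness (fun t x => forall e m c, e < t -> m < t -> level Z e m c ->
    forall s, bit s c -> ~ initial s x)) as [x Hx].
  - intros t y H e m c He Hm; apply H; lia.
  - intros t; destruct (choice (fun e c => mu_fin_le c (e + 2) /\
      forall m d, m < t -> level Z e m d -> forall s, bit s d -> bit s c)) as [C HC];
      [intros e; apply level_dominated|].
    destruct (uniform_bound (fun e L => (forall s, minimal s (C e) -> len s <= L) /\
      cnt (2 ^ L) (covered (C e) L) * 2 ^ (e + 2) <= 2 ^ L) t) as [L HL];
      [intros e; apply mu_fin_cover, HC|].
    destruct (cnt_lt (2 ^ L) (fun v => exists e, e < t /\ covered (C e) L v)) as [v [Hv Hn]].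
    { eapply Nat.le_lt_trans; [apply (cnt_union _ _ t (fun e => covered (C e) L)); auto|].
      apply geometric_union; intros e He; apply HL; auto. }
    exists (bits L v); intros e m c He Hm Hl s Hs Hi; apply Hn; exists e; split; auto.
    rewrite <- (val_bits L v Hv); apply (open_covered _ _ s); [apply HL; auto | | auto].
    apply (proj2 (HC e) m c); auto.
  - exists x; intros e m c Hl s Hs [k ->].
    destruct (Hx (S (Nat.max e m)) k) as [y [H1 H2]].
    apply (H1 e m c) with (s := str k x); auto; try lia.
    exists k; symmetry; apply str_agree; auto.
Qed.

Lemma random_rel_ml_test (z x : nat -> bool) B :
  random_rel z x -> ml_test B (fun n => z n = true) ->
  ~ forall n, in_open x (fun i c => B (pr (pr n i) c)).
Proof.
  (* The index [e] by which [B] is computed determines the component [e + 2] that [x] must avoid. *)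
  intros HR (HB & [e He] & Hmu) Hx.
  destruct (Hx (e + 2)) as (m & c & Hmc & s & Hs & Hi).
  destruct (Hmu (e + 2) m) as (d & Hd & Hbit).
  destruct (choice _ (fun i => HB (pr (e + 2) i))) as [cs Hcs].
  apply (HR e m d) with (s := s); auto.
  - exists cs; split; [|split; auto].
    + intros i _; split; [apply He, Hcs|]; intros c' Hc'; apply He; intros HB'.
      apply (proj2 (Hcs i)) in HB'; lia.
    + intros s'; rewrite Hbit; split.
      * intros (i & b & Hi' & Hb & Hs'); exists i; split; auto.
        apply (proj2 (Hcs i)) in Hb; congruence.
      * intros (i & Hi' & Hs'); exists i, (cs i); repeat split; auto; apply Hcs.
  - apply Hbit; exists m, c; auto.
Qed.

(** * A closed set of codes of Scott sets *)

Fixpoint enc_term (t : term) : nat :=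
  match t with
  | Var i => pr 0 i
  | Zero => pr 1 0
  | One => pr 2 0
  | Add s u => pr 3 (pr (enc_term s) (enc_term u))
  | Mul s u => pr 4 (pr (enc_term s) (enc_term u))
  end.

Fixpoint enc_formula (f : formula) : nat :=
  match f with
  | Eq s t => pr 0 (pr (enc_term s) (enc_term t))
  | Lt s t => pr 1 (pr (enc_term s) (enc_term t))
  | Mem t X => pr 2 (pr (enc_term t) X)
  | Bot => pr 3 0
  | Imp g h => pr 4 (pr (enc_formula g) (enc_formula h))
  | And g h => pr 5 (pr (enc_formula g) (enc_formula h))
  | Or g h => pr 6 (pr (enc_formula g) (enc_formula h))
  | AllN g => pr 7 (enc_formula g)
  | ExN g => pr 8 (enc_formula g)
  | AllS g => pr 9 (enc_formula g)
  | ExS g => pr 10 (enc_formula g)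
  end.

Fixpoint enc_list (l : list nat) : nat :=
  match l with [] => 0 | a :: l' => S (pr a (enc_list l')) end.

Ltac pr_inj := repeat match goal with
  | H : pr _ _ = pr _ _ |- _ => apply pr_inj in H; destruct H
  | H : S _ = S _ |- _ => injection H as H
  end.

Lemma enc_term_inj s t : enc_term s = enc_term t -> s = t.
Proof.
  revert t; induction s; intros []; cbn [enc_term]; intros H; pr_inj;
    try discriminate; f_equal; auto.
Qed.

Lemma enc_formula_inj f g : enc_formula f = enc_formula g -> f = g.
Proof.
  revert g; induction f; intros []; cbn [enc_formula]; intros H; pr_inj;
    try discriminate; f_equal; auto using enc_term_inj.
Qed.

Lemma enc_list_inj l l' : enc_list l = enc_list l' -> l = l'.
Proof.
  revert l'; induction l; intros []; cbn [enc_list]; intros H; pr_inj;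
    try discriminate; f_equal; auto.
Qed.

Lemma enc_list_nth l i : nth i l 0 <= enc_list l.
Proof.
  revert i; induction l as [|a l IH]; intros [|i]; cbn [nth enc_list]; try lia.
  - pose proof (pr_le_l a (enc_list l)); lia.
  - specialize (IH i); pose proof (pr_le_r a (enc_list l)); lia.
Qed.

(** A race between a witness for [F] and a counterexample to [G], ties going to [F]. At most one
    side wins, so the requirement can be met for all [F] and [G]; for fixed [n] and [a] only a
    bounded search is involved, so it is closed when they are bounded formulas. *)
Definition separates (F G : nat -> nat -> Prop) (x : nat -> bool) : Prop := forall n a,
  (F a n /\ (forall b, b < a -> G b n) -> x n = true) /\
  (~ G a n /\ (forall b, b <= a -> ~ F b n) -> x n = false).

(** Serves to make the Demuth tests coded in the oracle members of the model. *)
Definition section_rel (c : nat) (z x : nat -> bool) : Prop := forall n, x n = z (pr c n).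

Definition bin_rel (k : nat) : (nat -> bool) -> (nat -> bool) -> Prop :=
  match k with 0 => path_rel | 1 => random_rel | S (S c) => section_rel c end.

Lemma bin_rel_total k : total2 (bin_rel k).
Proof.
  destruct k as [|[|c]]; [apply path_rel_total | apply random_rel_total|].
  intros z; exists (fun n => z (pr c n)); intros n; reflexivity.
Qed.

Lemma bin_rel_closed k : closed2 (bin_rel k).
Proof.
  destruct k as [|[|c]]; [apply path_rel_closed | apply random_rel_closed|].
  intros z x H n; destruct (H (S (pr c n))) as (z' & x' & Hz & Hx & HR).
  pose proof (pr_le_r c n); rewrite <- Hz, <- Hx by lia; apply HR.
Qed.

(* [Sep f g vs cs]: the column separates the Sigma^0_1 property [ExN f] from the negation
   of [AllN g], with number parameters [vs] and as set parameters the columns [cs].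
   [Bin k i]: the column is related by [bin_rel k] to column [i]. *)
Inductive req : Type :=
| Sep (f g : formula) (vs cs : list nat)
| Bin (k i : nat).

Definition enc_req (r : req) : nat :=
  match r with
  | Sep f g vs cs =>
      pr 1 (pr (pr (enc_formula f) (enc_formula g)) (pr (enc_list vs) (enc_list cs)))
  | Bin k i => pr 2 (pr k i)
  end.

Definition columns (Y : nat -> nat -> bool) (cs : list nat) : nat -> nat -> Prop :=
  fun X n => Y (nth X cs 0) n = true.

Definition holds_at (Y : nat -> nat -> bool) (vs cs : list nat) (f : formula)
    (a n : nat) : Prop :=
  sat (omega (fun _ => True)) (scons a (scons n (fun i => nth i vs 0))) (columns Y cs) f.

Definition meets (Y : nat -> nat -> bool) (r : req) (x : nat -> bool) : Prop :=
  match r with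
  | Sep f g vs cs => delta00 f -> delta00 g ->
      separates (holds_at Y vs cs f) (holds_at Y vs cs g) x
  | Bin k i => bin_rel k (Y i) x
  end.

Lemma enc_req_inj r r' : enc_req r = enc_req r' -> r = r'.
Proof.
  destruct r, r'; unfold enc_req; intros H; pr_inj; try discriminate; f_equal;
    auto using enc_formula_inj, enc_list_inj.
Qed.

(** Column 0 is thus not claimed by any requirement and may be any given set. *)
Lemma enc_req_pos r : 0 < enc_req r.
Proof.
  destruct r; cbn [enc_req];
    (eapply Nat.le_lt_trans; [apply Nat.le_0_l | apply pr_lt_r; lia]).
Qed.

(** A requirement mentions only columns before the one that has to meet it, the default column 0
    included; so the columns can be chosen by recursion. *)
Lemma enc_req_nth f g vs cs X : nth X cs 0 < enc_req (Sep f g vs cs).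
Proof.
  cbn [enc_req]; eapply Nat.le_lt_trans; [apply enc_list_nth|].
  eapply Nat.le_lt_trans; [|apply pr_lt_r; lia].
  etransitivity; [|apply pr_le_r]; apply pr_le_r.
Qed.

Lemma enc_req_bin k i : i < enc_req (Bin k i).
Proof.
  cbn [enc_req]; eapply Nat.le_lt_trans; [|apply pr_lt_r; lia]; apply pr_le_r.
Qed.

Lemma meets_total Y r : exists x, meets Y r x.
Proof.
  destruct r as [f g vs cs|k i]; simpl; [|apply bin_rel_total].
  set (F := holds_at Y vs cs f); set (G := holds_at Y vs cs g).
  (* The bit is [true] exactly where [F] wins the race; a win of the other side then leads to a
     contradiction, whichever witness is smaller. *)
  exists (chi (fun n => exists a, F a n /\ forall b, b < a -> G b n)).
  intros _ _ n a; split.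
  - intros H; apply chi_true; eauto.
  - intros [H1 H2]; destruct (chi _ n) eqn:E; auto.
    apply chi_true in E as [a' [H3 H4]]; exfalso.
    destruct (Nat.lt_ge_cases a a') as [L|L]; [apply H1; auto | apply (H2 a'); auto].
Qed.

Lemma meets_local Y Y' r x : agree (enc_req r) Y Y' -> meets Y r x -> meets Y' r x.
Proof.
  intros H; destruct r as [f g vs cs|k i]; simpl.
  - unfold holds_at; replace (columns Y' cs) with (columns Y cs); auto.
    apply functional_extensionality; intros X; unfold columns.
    now rewrite H by apply enc_req_nth.
  - now rewrite H by apply enc_req_bin.
Qed.

(** * Columns and the closed class *)

(** In this bijection the first [n] bits of column [e] lie within a length linear in [n] for fixed
    [e]. This is why the changes are bounded by a power [k ^ n]; a quadratic pairing would not give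
    that. *)
Definition pos (e j : nat) : nat := Nat.pred (2 ^ e * (2 * j + 1)).
Definition col (A : nat -> bool) (e j : nat) : bool := A (pos e j).

Lemma pos_succ e j : S (pos e j) = 2 ^ e * (2 * j + 1).
Proof. unfold pos; pose proof (pow2_pos e); nia. Qed.

Lemma pos_inj e j e' j' : pos e j = pos e' j' -> e = e' /\ j = j'.
Proof.
  intros H; apply (f_equal S) in H; rewrite !pos_succ in H; revert e' H.
  induction e as [|e IH]; intros [|e']; cbn [Nat.pow]; intros H; try lia.
  destruct (IH e'); lia.
Qed.

Lemma pos_surj n : exists e j, n = pos e j.
Proof.
  enough (H : forall m, 0 < m -> exists e j, m = 2 ^ e * (2 * j + 1)).
  { destruct (H (S n)) as (e & j & E); [lia|]; exists e, j; rewrite <- pos_succ in E; lia. }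
  induction m as [m IH] using lt_wf_ind; intros Hm.
  destruct (Nat.Even_or_Odd m) as [[k ->]|[k ->]].
  - destruct (IH k) as (e & j & ->); [lia | lia|]; exists (S e), j; simpl; lia.
  - exists 0, k; simpl; lia.
Qed.

Lemma pos_lt e j w n : e <= w -> j < n -> pos e j < 2 ^ w * (2 * n + 1).
Proof.
  intros He Hj; pose proof (pos_succ e j).
  assert (2 ^ e <= 2 ^ w) by (apply Nat.pow_le_mono_r; lia); nia.
Qed.

Lemma col_agree A A' w n e :
  agree (2 ^ w * (2 * n + 1)) A A' -> e <= w -> agree n (col A e) (col A' e).
Proof. intros H He j Hj; apply H, pos_lt; auto. Qed.

Lemma col_exists (Y : nat -> nat -> bool) : exists A, col A = Y.
Proof.
  destruct (choice (fun n p => n = pos (fst p) (snd p))) as [d Hd].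
  { intros n; destruct (pos_surj n) as (e & j & H); exists (e, j); exact H. }
  exists (fun n => Y (fst (d n)) (snd (d n))).
  apply functional_extensionality; intros e; apply functional_extensionality; intros j.
  unfold col; destruct (pos_inj _ _ _ _ (Hd (pos e j))) as [<- <-]; reflexivity.
Qed.

Definition scott (A : nat -> bool) : Prop :=
  forall r, meets (col A) r (col A (enc_req r)).

Lemma scott_exists z : exists A, scott A /\ col A 0 = z.
Proof.
  destruct (strong_recursion z (fun Y n x => (n = 0 -> x = z) /\
    forall r, n = enc_req r -> meets Y r x)) as [Y HY].
  - intros Y Y' n x H [H1 H2]; split; auto; intros r ->.
    apply (meets_local Y); [exact H | auto].
  - intros Y n; destruct (classic (exists r, n = enc_req r)) as [[r ->]|H].
    + destruct (meets_total Y r) as [x Hx]; exists x; split.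
      * pose proof (enc_req_pos r); lia.
      * intros r' E; apply enc_req_inj in E as <-; auto.
    + exists z; split; auto; intros r E; exfalso; eauto.
  - destruct (col_exists Y) as [A HA]; exists A; unfold scott; rewrite HA; split.
    + intros r; apply HY; auto.
    + apply HY; auto.
Qed.

(** Requirement [r] concerns only columns up to [enc_req r], and a long enough agreement of [A']
    with [A] makes all of these agree to any desired length. Bounded formulas have a finite use, and
    the binary relations are closed. *)
Lemma scott_closed A :
  (forall u, exists A', scott A' /\ agree u A' A) -> scott A.
Proof.
  intros H r.
  assert (Hcol : forall u, exists A', scott A' /\ forall e, e <= enc_req r ->
    agree u (col A' e) (col A e)).
  { intros u; destruct (H (2 ^ enc_req r * (2 * u + 1))) as [A' [H1 H2]].
    exists A'; split; auto; intros e; now apply col_agree. }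
  clear H; destruct r as [f g vs cs|k i].
  - intros Hf Hg n a.
    assert (Huse : forall f, delta00 f -> exists u, forall b, b < S a -> forall u', u <= u' ->
      forall V' : nat -> nat -> Prop, (forall X m, X < u' -> m < u' ->
        columns (col A) cs X m <-> V' X m) ->
      holds_at (col A) vs cs f b n <->
      sat (omega (fun _ => True)) (scons b (scons n (fun i => nth i vs 0))) V' f).
    { intros k Hk; apply (bounded_choice_max (fun b u' =>
        forall V' : nat -> nat -> Prop, (forall X m, X < u' -> m < u' ->
          columns (col A) cs X m <-> V' X m) ->
        holds_at (col A) vs cs k b n <->
        sat (omega (fun _ => True)) (scons b (scons n (fun i => nth i vs 0))) V' k)).
      intros b _; now apply delta00_use. }
    destruct (Huse f Hf) as [u1 Hu1], (Huse g Hg) as [u2 Hu2]; clear Huse.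
    (* [S n] secures bit [n] of the separating column, [u1] and [u2] secure the truth of both
       formulas for all witnesses up to [a]. *)
    set (u := Nat.max (S n) (Nat.max u1 u2)).
    destruct (Hcol u) as [A' [HA' Hag]].
    assert (HV : forall X m, X < u -> m < u -> columns (col A) cs X m <-> columns (col A') cs X m).
    { intros X m _ Hm; unfold columns; rewrite <- Hag; auto; [tauto|].
      apply Nat.lt_le_incl, enc_req_nth. }
    assert (Ff : forall b, b <= a -> holds_at (col A) vs cs f b n <-> holds_at (col A') vs cs f b n)
      by (intros b Hb; apply (Hu1 b ltac:(lia) u); auto; lia).
    assert (Fg : forall b, b <= a -> holds_at (col A) vs cs g b n <-> holds_at (col A') vs cs g b n)
      by (intros b Hb; apply (Hu2 b ltac:(lia) u); auto; lia).
    rewrite <- (Hag _ (le_n _) n) by lia.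
    destruct (HA' (Sep f g vs cs) Hf Hg n a) as [H1 H2]; split; intros [H3 H4];
      [apply H1 | apply H2]; rewrite ?Ff, ?Fg in H3 by auto; (split; [exact H3|]);
      intros b Hb; specialize (H4 b Hb); rewrite ?Ff, ?Fg in H4 by lia; exact H4.
  - apply bin_rel_closed; intros u; destruct (Hcol u) as [A' [HA' Hag]].
    exists (col A' i), (col A' (enc_req (Bin k i))); repeat split.
    + apply Hag, Nat.lt_le_incl, enc_req_bin.
    + apply Hag; auto.
    + exact (HA' (Bin k i)).
Qed.

(** * The self-coding oracle *)

Definition stage (Z : nat -> bool) (t : nat) (A : nat -> bool) : Prop :=
  scott A /\ agree t (col A 0) Z.

(** The number [2 ^ s] is the canonical index of the singleton of [s]. So this is an index for the
    open set of all extensions of one string of length [n], of measure $2^{-n}$. *)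
Definition approx (Z : nat -> bool) (e n t : nat) : nat :=
  i_const (2 ^ str n (col (leftmost (stage Z t)) e)).

(* The oracle codes, in position <<e,s0>,<<n,s>,v>>, the value v of a Demuth test for
   column e, delayed by s0 stages; this value only depends on what lies below s and s0,
   which makes the definition of the oracle a recursion. *)
Definition self_coding (Z : nat -> bool) : Prop := forall x,
  Z x = true <-> exists e s0 n s,
    x = pr (pr e s0) (pr (pr n s) (approx Z e n (Nat.max s s0))).

Lemma stage_local Z Z' t : agree t Z Z' -> stage Z t = stage Z' t.
Proof.
  intros H; apply functional_extensionality; intros A; apply propositional_extensionality.
  unfold stage; split; intros [H1 H2]; split; auto; intros j Hj;
    rewrite H2 by auto; [|symmetry]; auto.
Qed.

Lemma self_coding_exists : exists Z, self_coding Z.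
Proof.
  apply (strong_recursion false (fun Z x b => b = true <-> exists e s0 n s,
    x = pr (pr e s0) (pr (pr n s) (approx Z e n (Nat.max s s0))))).
  - intros Z Z' x b H ->.
    enough (E : forall e s0 n s v, x = pr (pr e s0) (pr (pr n s) v) ->
      approx Z e n (Nat.max s s0) = approx Z' e n (Nat.max s s0)).
    { split; intros (e & s0 & n & s & Hx); exists e, s0, n, s;
        pose proof (E _ _ _ _ _ Hx); congruence. }
    intros e s0 n s v Hx; unfold approx; rewrite (stage_local Z Z'); auto.
    intros i Hi; apply H.
    pose proof (pr_le_l (pr e s0) (pr (pr n s) v)); pose proof (pr_le_r e s0).
    pose proof (pr_le_r (pr e s0) (pr (pr n s) v)); pose proof (pr_le_l (pr n s) v).
    pose proof (pr_le_r n s); lia.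
  - intros Z x; match goal with |- exists b, _ <-> ?Q => exists (chi (fun _ => Q) 0) end.
    apply (chi_true (fun _ => _) 0).
Qed.

Lemma stage_decreasing Z t A : stage Z (S t) A -> stage Z t A.
Proof. intros [H1 H2]; split; auto; eapply agree_le; [|exact H2]; lia. Qed.

Lemma stage_nonempty Z t : exists A, stage Z t A.
Proof.
  destruct (scott_exists Z) as [A [H1 H2]]; exists A; split; auto.
  intros j _; now rewrite H2.
Qed.

Lemma scott_limit Z : exists A, scott A /\ col A 0 = Z /\
  forall m, exists t0, forall t, t0 <= t -> agree m (leftmost (stage Z t)) A.
Proof.
  destruct (leftmost_limit (stage Z)) as [A HA];
    [apply stage_decreasing | apply stage_nonempty|].
  assert (H : forall m, exists A', stage Z m A' /\ agree m A' A).
  { intros m; destruct (HA m) as [t0 Ht0].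
    destruct (leftmost_attained (stage Z (Nat.max m t0)) m (stage_nonempty _ _)) as [A' [H1 H2]].
    exists A'; split.
    - revert H1; apply decreasing_le; [apply stage_decreasing | lia].
    - intros i Hi; rewrite H2, Ht0 by lia; reflexivity. }
  exists A; split; [|split; auto].
  - apply scott_closed; intros u; destruct (H u) as [A' [[H1 _] H2]]; eauto.
  - apply functional_extensionality; intros j.
    (* As [pos 0 j] is [2 * j], this stage covers both position [pos 0 j] of [A] and bit [j] of
       column 0. *)
    destruct (H (S (pos 0 j))) as [A' [[_ H1] H2]].
    unfold col; rewrite <- H2, <- H1 by (unfold pos; simpl; lia); reflexivity.
Qed.

(** * The model omits h-weakly Demuth randoms *)

Definition column_sets (A : nat -> bool) (X : nat -> Prop) : Prop :=
  exists e, X = fun n => col A e n = true.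

Lemma cnt_changes f N : (forall s, f s <= f (S s)) ->
  cnt N (fun s => f s <> f (S s)) + f 0 <= f N.
Proof.
  intros H; induction N as [|N IH]; unfold cnt in *; cbn [sum]; [lia|].
  specialize (H N); destruct (chi _ N) eqn:E; cbn [Nat.b2n]; [|lia].
  apply chi_true in E; lia.
Qed.

Lemma card_le_cnt c P : (forall s, bit s c -> P s) -> card c <= cnt c P.
Proof.
  intros H; apply sum_le; intros s _; destruct (Nat.testbit c s) eqn:E; simpl; [|lia].
  apply H, chi_true in E; rewrite E; auto.
Qed.

Lemma mu_le_single Z n x : mu_le (phi Z (i_const (2 ^ str n x))) n.
Proof.
  set (s := str n x); intros m; exists (2 ^ s); split.
  - exists n, (fun i => if i =? s then 1 else 0); split.
    + intros t Ht; destruct (Nat.eqb_spec t s) as [->|Hts].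
      * left; unfold s; rewrite len_str, Nat.sub_diag; fold s; repeat split; auto.
        -- now apply bit_pow2.
        -- intros (t & H1 & _ & H2); apply bit_pow2 in H1; tauto.
      * right; split; auto; intros [H _]; apply bit_pow2 in H; tauto.
    + rewrite sum_single; [lia | apply Nat.pow_gt_lin_r; lia].
  - intros t; split.
    + intros Ht; exists 0, (2 ^ s); repeat split; auto using phi_const; lia.
    + intros (i & b & _ & Hb & Ht).
      now rewrite (phi_functional _ _ _ _ _ (phi_const Z (2 ^ s) i) Hb).
Qed.

Lemma approx_change Z e n t t' :
  let m := 2 ^ e * (2 * n + 1) in
  val m (leftmost (stage Z t)) = val m (leftmost (stage Z t')) ->
  approx Z e n t = approx Z e n t'.
Proof.
  intros m H; unfold approx; do 2 f_equal; apply str_agree.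
  apply (col_agree _ _ e); auto; now apply agree_val.
Qed.

Lemma not_demuth_randoms h Z A :
  (forall k, eventually_dominates h (fun n => Nat.pow k n)) ->
  self_coding Z -> scott A -> col A 0 = Z ->
  (forall m, exists t0, forall t, t0 <= t -> agree m (leftmost (stage Z t)) A) ->
  ~ demuth_randoms h (column_sets A).
Proof.
  intros Hh HZ HA H0 Hlim H.
  destruct (H (fun n => Z n = true)) as [X [[e ->] HX]]; [exists 0; now rewrite H0|].
  (* For [n] at least 1, the relevant length [2 ^ e * (2 * n + 1)] is at most [3 * 2 ^ e * n], so
     there are fewer than [k ^ n] changes for this [k]. *)
  destruct (Hh (2 ^ (3 * 2 ^ e))) as [n0 Hn0].
  (* From stage [s0] on, the approximations for all [n] up to [n0], where [h] may be too small, have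
     settled. *)
  destruct (Hlim (2 ^ e * (2 * n0 + 1))) as [s0 Hs0].
  set (g := fun x => Z (pr (pr e s0) x) = true).
  assert (Hg : forall n s v, g (pr (pr n s) v) <-> v = approx Z e n (Nat.max s s0)).
  { intros n s v; unfold g; rewrite (HZ _); split.
    - intros (e' & s0' & n' & s' & E); pr_inj; subst; reflexivity.
    - intros ->; exists e, s0, n, s; reflexivity. }
  assert (Hlimit : forall n, lim g n (i_const (2 ^ str n (col A e)))).
  { intros n; destruct (Hlim (2 ^ e * (2 * n + 1))) as [t0 Ht0].
    exists t0; intros s Hs; apply Hg; unfold approx; do 2 f_equal; symmetry.
    apply str_agree, (col_agree _ _ e); auto; apply Ht0; lia. }
  assert (Hunique : forall n v, lim g n v -> v = i_const (2 ^ str n (col A e))).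
  { intros n v [t1 H1]; destruct (Hlimit n) as [t2 H2].
    specialize (H1 (Nat.max t1 t2) ltac:(lia)); specialize (H2 (Nat.max t1 t2) ltac:(lia)).
    apply Hg in H1, H2; congruence. }
  destruct (HX g) as (n & v & Hv & Hopen).
  (* The test is a section of column 0, hence itself a column. *)
  - exists (enc_req (Bin (S (S (pr e s0))) 0)).
    apply functional_extensionality; intros x; unfold g.
    now rewrite (HA (Bin (S (S (pr e s0))) 0) x), H0.
  - split; [split|split].
    + intros x; destruct (pr_surj x) as (n & s & ->); eexists; split.
      * apply Hg; reflexivity.
      * intros v Hv; now apply Hg in Hv.
    + intros n.
      set (f := fun s => val (2 ^ e * (2 * n + 1)) (leftmost (stage Z (Nat.max s s0)))).
      assert (Hmono : forall s, f s <= f (S s)).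
      { intros s; apply leftmost_antitone; [|apply stage_nonempty].
        intros y; apply decreasing_le; [apply stage_decreasing | lia]. }
      assert (Hchange : forall s, change g n s -> f s <> f (S s)).
      { intros s (u & v & Hu & Hv & Huv) E; apply Huv; apply Hg in Hu, Hv; subst.
        apply approx_change; unfold f in E; now rewrite (Nat.add_1_r s). }
      destruct (nondecreasing_stable f (2 ^ (2 ^ e * (2 * n + 1)))) as [s1 Hs1];
        [exact Hmono | intros; apply val_lt|].
      destruct (bit_comprehension (change g n) s1) as [c Hc].
      { intros s Hs; apply Nat.nle_gt; intros L; apply (Hchange s Hs).
        transitivity (f s1); [|symmetry]; apply Hs1; lia. }
      exists c; split; [exact Hc|].
      (* Each change raises the nondecreasing [f], and all elements of [c] are below [c]; so
         counting up to stage [c] finds every change. *)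
      assert (Hcard : card c + f 0 <= f c).
      { etransitivity; [apply Nat.add_le_mono_r|]; [|apply (cnt_changes f c Hmono)].
        apply card_le_cnt; intros s Hs; apply Hchange, Hc, Hs. }
      destruct (Nat.le_gt_cases n n0) as [L|L].
      * assert (E : f c = f 0).
        { unfold f; apply val_agree; intros i Hi.
          rewrite !Hs0; auto; try lia; eapply Nat.lt_le_trans; eauto;
            apply Nat.mul_le_mono_l; lia. }
        lia.
      * specialize (Hn0 n L); rewrite <- Nat.pow_mul_r in Hn0.
        pose proof (val_lt (2 ^ e * (2 * n + 1)) (leftmost (stage Z (Nat.max c s0)))).
        assert (2 ^ (2 ^ e * (2 * n + 1)) <= 2 ^ (3 * 2 ^ e * n))
          by (apply Nat.pow_le_mono_r; nia).
        unfold f in Hcard at 2; lia.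
    + exact (turing_le_section (fun n => Z n = true) (pr e s0)).
    + intros n; eexists; split; [apply Hlimit|]; split; [|apply mu_le_single].
      intros i; eexists; apply phi_const.
  (* Component [n] of the test consists of the sets that extend the first [n] bits of column [e], so
     the column lies in every component. *)
  - apply Hopen; apply Hunique in Hv as ->.
    exists 0, (2 ^ str n (col A e)); split; [apply phi_const|].
    exists (str n (col A e)); split; [now apply bit_pow2|].
    rewrite chi_bool; exists n; reflexivity.
Qed.

(** * The theorem *)

Lemma weak_koenig_columns A : scott A -> weak_koenig (column_sets A).
Proof.
  intros HA T [i ->] [HT Hinf].
  exists (fun n => col A (enc_req (Bin 0 i)) n = true); split; [eexists; reflexivity|].
  rewrite chi_bool; apply path_rel_weak_koenig; auto; exact (HA (Bin 0 i)).
Qed.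

Lemma ml_randoms_columns A : scott A -> ml_randoms (column_sets A).
Proof.
  intros HA Z [i ->].
  exists (fun n => col A (enc_req (Bin 1 i)) n = true); split; [eexists; reflexivity|].
  rewrite chi_bool; intros B _; apply random_rel_ml_test; exact (HA (Bin 1 i)).
Qed.

Lemma holds_PA_minus P f : In f PA_minus -> holds (omega P) f.
Proof.
  intros H v V; revert f H; apply Forall_forall; unfold PA_minus; cbn [map].
  repeat (apply Forall_cons; [cbn; intros; try lia; try nia|]); try apply Forall_nil.
  - exists (a0 - a); lia.
  - split; [|intros]; lia.
Qed.

Lemma sat_induction P v V f : sat (omega P) v V (induction f).
Proof.
  intros [H0 HS] a; apply sat_instN in H0; cbn in H0.
  induction a as [|a IH]; [exact H0|].
  specialize (HS a IH); rewrite sat_subst in HS; revert HS.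
  rewrite <- Nat.add_1_r.
  match goal with |- sat _ ?u _ _ -> sat _ ?w _ _ => replace u with w; [auto|] end.
  apply functional_extensionality; intros [|i]; reflexivity.
Qed.

(** By hypothesis, [ExN f0] and the negation of [AllN g0] are complementary, so a column separating
    them is the set to be found. *)
Lemma sat_comprehension A f g v V :
  scott A -> sigma01 f -> pi01 g -> (forall X, column_sets A (V X)) ->
  sat (omega (column_sets A)) v V (comprehension f g).
Proof.
  intros HA [f0 [Hf ->]] [g0 [Hg ->]] HV Hfg; cbn [sat] in Hfg.
  destruct (choice _ HV) as [c Hc].
  set (k := Nat.max (Nat.max (fvN f0) (fvN g0)) (Nat.max (fvS f0) (fvS g0))).
  (* A requirement has finite parameter lists; length [k] covers all free variables of both
     formulas. *)
  set (vs := map v (seq 0 k)); set (cs := map c (seq 0 k)).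
  assert (Hnth : forall (p : nat -> nat) i, i < k -> nth i (map p (seq 0 k)) 0 = p i).
  { intros p i Hi; rewrite (nth_indep _ 0 (p 0)) by now rewrite length_map, length_seq.
    rewrite map_nth, seq_nth; auto. }
  assert (Hat : forall d, delta00 d -> fvN d <= k -> fvS d <= k -> forall a n,
    sat (omega (column_sets A)) (scons a (scons n v)) V d <-> holds_at (col A) vs cs d a n).
  { intros d Hd HdN HdS a n; unfold holds_at.
    rewrite (delta00_sat_sets _ (fun _ => True)) by auto; apply sat_coincidence.
    - intros [|[|i]] Hi; simpl; auto; symmetry; apply Hnth; lia.
    - intros X HX; unfold columns, cs; rewrite Hnth, Hc by lia; reflexivity. }
  pose proof (fun a n => Hat f0 Hf ltac:(lia) ltac:(lia) a n) as Ff.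
  pose proof (fun a n => Hat g0 Hg ltac:(lia) ltac:(lia) a n) as Fg; clear Hat.
  pose proof (HA (Sep f0 g0 vs cs) Hf Hg) as Hsep.
  set (e := enc_req (Sep f0 g0 vs cs)) in Hsep.
  exists (fun n => col A e n = true); split; [eexists; reflexivity|]; intros n.
  assert (E : col A e n = true <->
    sat (omega (column_sets A)) (scons n v) V (ExN f0)).
  { destruct (Hfg n) as [Hfg1 Hfg2]; cbn [sat] in *; split.
    - intros HX; apply NNPP; intros Hno.
      assert (Hg0 : exists b, ~ sat (omega (column_sets A)) (scons b (scons n v)) V g0).
      { apply not_all_ex_not; intros Hall; apply Hno, Hfg2, Hall. }
      destruct Hg0 as [b Hb]; rewrite Fg in Hb.
      destruct (Hsep n b) as [_ Hsep2]; rewrite Hsep2 in HX; [discriminate|].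
      split; [exact Hb|]; intros a _ Ha; apply Hno; exists a; now apply Ff.
    - intros [a Ha]; apply (Hsep n a); split; [now apply Ff|].
      intros b _; apply Fg, Hfg1; exists a; exact Ha. }
  split; intros H; [apply sat_liftS, E, H | apply E; apply sat_liftS in H; exact H].
Qed.

Lemma models_RCA0 A : scott A -> models (omega (column_sets A)) RCA0.
Proof.
  intros HA f Hf; assert (H0 : column_sets A (fun n => col A 0 n = true)) by now exists 0.
  destruct Hf as [f Hf|f Hf|f g Hf Hg].
  - now apply holds_PA_minus.
  - apply (holds_universal_closure (omega (column_sets A)) _ _ H0); intros; apply sat_induction.
  - apply (holds_universal_closure (omega (column_sets A)) _ _ H0); intros; now apply sat_comprehension.
Qed.

Theorem theorem7p7 (h : nat -> nat) (theta : formula)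
  (htheta : provably_total_def theta h)
  (hdom : forall k : nat, eventually_dominates h (fun n => Nat.pow k n)) :
  (exists S : (nat -> Prop) -> Prop,
     models (omega S) (add_axiom WKL0 (Neg (WDR theta)))) /\
  ~ proves WKL0 (WDR theta) /\
  ~ proves RCA0 (Imp MLR (WDR theta)).
Proof.
  destruct htheta as (Hsigma & _ & _ & Hdef & _).
  destruct self_coding_exists as [Z HZ], (scott_limit Z) as (A & HA & H0 & Hlim).
  pose proof (fun P => Sem_happ2 P h theta Hsigma Hdef) as Hsem.
  pose proof (not_demuth_randoms h Z A hdom HZ HA H0 Hlim) as Hnot.
  assert (HRCA := models_RCA0 A HA).
  assert (HWKL : models (omega (column_sets A)) WKL0).
  { intros f [Hf | ->]; [now apply HRCA|].
    intros v V; apply sat_weak_Koenig, weak_koenig_columns, HA. }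
  assert (HWDR : forall v V, ~ sat (omega (column_sets A)) v V (WDR theta))
    by (intros v V H; exact (Hnot (proj1 (sat_WDR _ h theta v V (Hsem _)) H))).
  assert (HS : sets_of (omega (column_sets A)) (fun n => col A 0 n = true)) by now exists 0.
  split; [|split].
  - exists (column_sets A); intros f [Hf | ->]; [now apply HWKL | exact HWDR].
  - intros H; exact (HWDR _ _ (proves_sound _ _ _ _ HWKL HS H (fun _ => 0))).
  - intros H; apply (HWDR (fun _ => 0) (fun _ n => col A 0 n = true)).
    apply (proves_sound _ _ _ _ HRCA HS H (fun _ => 0)).
    apply sat_MLR, ml_randoms_columns, HA.
Qed.
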